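(* Let $\mathcal{G}$ be a connected undirected graph on nodes $\{1,\dots,N\}$ with adjacency matrix $\mathbf{A}=[a_{ij}]$ ($a_{ij}=a_{ji}=1$ if $i,j$ are adjacent, $0$ otherwise, $a_{ii}=0$). Let $f^1,\dots,f^N:\mathbb{R}^d\to\mathbb{R}$ be twice continuously differentiable with $\underline{m}^i\mathbf{I}\preceq\mathbf{H}^i(\mathbf{x})\preceq\bar m^i\mathbf{I}$ for all $\mathbf{x}$, for constants $0<\underline{m}^i\le\bar m^i$, where $\mathbf{g}^i=\nabla f^i$, $\mathbf{H}^i=\nabla^2 f^i$, and let $\mathbf{x}^\star$ be the unique minimizer of $f=\sum_{i=1}^N f^i$ over $\mathbb{R}^d$. Consider the distributed HISO algorithm, for $i=1,\dots,N$, $$\mathbf{z}^i=\mathbf{g}^i(\mathbf{x}^i)+\mathbf{v}^i,$$ $$\dot{\mathbf{v}}^i=-\sum_{j=1}^N a_{ij}\,\mathrm{sgn}(\mathbf{z}^i-\mathbf{z}^j)+\sum_{j=1}^N a_{ij}(\mathbf{x}^i-\mathbf{x}^j),$$ $$\dot{\mathbf{x}}^i=-\mathbf{H}^i(\mathbf{x}^i)^{-1}\Big(\mathbf{z}^i+\sum_{j=1}^N a_{ij}(\mathbf{x}^i-\mathbf{x}^j)\Big),$$ with solutions understood in the sense of Filippov. Then, for any initial conditions $\mathbf{x}^i(0),\mathbf{v}^i(0)\in\mathbb{R}^d$ satisfying $\sum_{i=1}^N\mathbf{v}^i(0)=\mathbf{0}$, every $\mathbf{x}^i(t)$ converges to $\mathbf{x}^\star$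 and every $\mathbf{z}^i(t)$ converges to $\mathbf{0}$ as $t\to\infty$.
   Context: $\mathrm{sgn}$ is applied componentwise to vectors in $\mathbb{R}^d$. $\mathbf{I}$ is the $d\times d$ identity and $\preceq$ the Loewner order. *)

(* Defs.v *)
From HB Require Import structures.
From mathcomp Require Import all_boot all_order all_algebra.
From mathcomp Require Import all_classical all_reals all_analysis.
Import Order.TTheory GRing.Theory Num.Theory numFieldNormedType.Exports.
Set Implicit Arguments. Unset Strict Implicit. Unset Printing Implicit Defensive.
Local Open Scope classical_set_scope.
Local Open Scope ring_scope.

Definition gradient (R : realType) (d : nat) (f : 'rV[R]_d -> R) (x : 'rV[R]_d)
  : 'rV[R]_d := \row_k 'D_(delta_mx 0 k) f x.

Definition hessian (R : realType) (d : nat) (f : 'rV[R]_d -> R) (x : 'rV[R]_d)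
  : 'M[R]_d := \matrix_(k, l) 'D_(delta_mx 0 l) (fun y => gradient f y 0 k) x.

Definition C2 (R : realType) (d : nat) (f : 'rV[R]_d -> R) : Prop :=
  (forall x, differentiable f x) /\
  (forall x, differentiable (gradient f) x) /\
  continuous (hessian f).

Definition psd (R : realType) (d : nat) (M : 'M[R]_d) : Prop :=
  forall u : 'rV[R]_d, 0 <= (u *m M *m u^T) 0 0.
Definition loewner_le (R : realType) (d : nat) (A B : 'M[R]_d) : Prop :=
  psd (B - A).

Definition is_adjacency (R : realType) (N : nat) (A : 'M[R]_N) : Prop :=
  (forall i j, A i j = 0 \/ A i j = 1) /\
  (forall i j, A i j = A j i) /\
  (forall i, A i i = 0).

Definition graph_connected (R : realType) (N : nat) (A : 'M[R]_N) : Prop :=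
  forall i j : 'I_N, connect [rel a b | A a b == 1] i j.

(* ---------- The HISO vector field ----------
   The full state is Y : 'M_(N + N, d); row i of X := usubmx Y is x^i,
   row i of V := dsubmx Y is v^i. *)
Section hiso.
Variables (R : realType) (N d : nat).
Variables (A : 'M[R]_N) (f : 'I_N -> 'rV[R]_d -> R).

Definition sgn_vec (u : 'rV[R]_d) : 'rV[R]_d := map_mx Num.sg u.

Definition hiso_z (Y : 'M[R]_(N + N, d)) (i : 'I_N) : 'rV[R]_d :=
  gradient (f i) (row i (usubmx Y)) + row i (dsubmx Y).

Definition hiso_lap (Y : 'M[R]_(N + N, d)) (i : 'I_N) : 'rV[R]_d :=
  \sum_(j < N) A i j *: (row i (usubmx Y) - row j (usubmx Y)).

Definition hiso_vdot (Y : 'M[R]_(N + N, d)) (i : 'I_N) : 'rV[R]_d :=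
  - (\sum_(j < N) A i j *: sgn_vec (hiso_z Y i - hiso_z Y j)) + hiso_lap Y i.

Definition hiso_xdot (Y : 'M[R]_(N + N, d)) (i : 'I_N) : 'rV[R]_d :=
  - (invmx (hessian (f i) (row i (usubmx Y))) *m (hiso_z Y i + hiso_lap Y i)^T)^T.

Definition hiso_field (Y : 'M[R]_(N + N, d)) : 'M[R]_(N + N, d) :=
  col_mx (\matrix_(i < N) hiso_xdot Y i) (\matrix_(i < N) hiso_vdot Y i).
End hiso.

Section filippov.
Variables (R : realType) (m n : nat).
Local Notation S := 'M[R]_(m, n).

Definition in_box (a b x : S) : Prop := forall i j, a i j <= x i j <= b i j.
Definition box_vol (a b : S) : R := \prod_(i < m) \prod_(j < n) (b i j - a i j).
Definition null_set (E : set S) : Prop :=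
  forall eps : R, 0 < eps -> exists a b : nat -> S,
    [/\ (forall k i j, a k i j <= b k i j),
        E `<=` \bigcup_k [set x | in_box (a k) (b k) x] &
        forall K, \sum_(k < K) box_vol (a k) (b k) <= eps].

Definition convex (C : set S) : Prop :=
  forall x y (t : R), C x -> C y -> 0 <= t <= 1 -> C (t *: x + (1 - t) *: y).

Definition cl_conv (E : set S) : set S :=
  \bigcap_(C in [set C : set S | [/\ closed C, convex C & E `<=` C]]) C.

Definition filippov_map (F : S -> S) (y : S) : set S :=
  [set w | forall delta : R, 0 < delta -> forall E : set S, null_set E ->
     cl_conv (F @` (ball y delta `\` E)) w].

Definition abs_cont_on (a b : R) (y : R -> S) : Prop :=
  forall eps : R, 0 < eps -> exists2 del : R, 0 < del &
    forall (K : nat) (s t : 'I_K -> R),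
      (forall k, a <= s k /\ s k <= t k /\ t k <= b) ->
      (forall k l : 'I_K, (k < l)%N -> t k <= s l) ->
      \sum_(k < K) (t k - s k) < del ->
      \sum_(k < K) `|y (t k) - y (s k)| < eps.

Definition filippov_solution (F : S -> S) (y : R -> S) : Prop :=
  (forall T : R, 0 < T -> abs_cont_on 0 T y) /\
  {ae (@lebesgue_measure R), forall t : R, 0 < t ->
     derivable y t 1 /\ filippov_map F (y t) (derive1 y t)}.
End filippov.

(* Main.v *)
(* Along a solution z_i obeys z_i' = - z_i - \sum_j a_ij sgn(z_i - z_j): the
   Laplacian terms of x_i' and v_i' cancel.  The Bregman divergences
   f_i(xstar) - f_i(x_i) - <g_i(x_i), xstar - x_i> have derivative
   - <z_i + (Lx)_i, x_i - xstar>.  Since \sum_i v_i is conserved,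
   \sum_i g_i(x_i) = \sum_i z_i, and strong convexity with connectedness bounds
   \sum_i |x_i - xstar|^2 by a multiple of <x, Lx> + |z|^2.  Hence the sum U of the
   divergences and of a large multiple of |z|^2 satisfies U' <= - c U almost
   everywhere, (1 + c t) U(t) is nonincreasing, and U tends to 0.
   The Filippov inclusion is only used through linear functionals: one that is
   dominated on the vector field by a continuous function is dominated on the
   whole Filippov set.  The Lipschitz bound on the gradients comes from their
   cocoercivity, which bypasses the symmetry of the Hessians. *)

Require Import Defs.
From HB Require Import structures.
From mathcomp Require Import all_boot all_order all_algebra.
From mathcomp Require Import all_classical all_reals all_analysis.
From mathcomp Require Import measurable_realfun ring lra.
Import Order.TTheory GRing.Theory Num.Theory numFieldNormedType.Exports.
Set Implicit Arguments. Unset Strict Implicit. Unset Printing Implicit Defensive.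
Local Open Scope classical_set_scope.
Local Open Scope ring_scope.

(** * Absolutely continuous functions with nonpositive derivative *)

(** Two obstacles shape the proof. The coupling is discontinuous, so no formula for the Filippov set
    is sought: with z frozen at the current state, the inequality p sgn q >= - |p - q| bounds the
    sign term at nearby states by a continuous error that vanishes at the current one. The
    nonpositivity of the coupling thus survives convexification, and the decay of |z|^2 comes from
    the term - z_i. Second, solutions are only absolutely continuous, so the inequality on U' has to
    be integrated. A Cousin covering argument does this without Lebesgue integrals: absolute
    continuity pays for the intervals near the exceptional null set, and the derivative bound pays
    for the others. To apply it to U, the notion [dominated] records that increments are controlled
    by those of the trajectory and of time; on compact intervals this is stable under sums and
    products. The multiple of |z|^2 in U must be large because the divergences leave the cross term
    - <z_i, x_i - xstar>, which has no sign and is absorbed by Young's inequality. *)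

Lemma cousin (R : realType) (P : R -> R -> Prop) (a b : R) :
  a <= b ->
  (forall x y z, x <= y -> y <= z -> P x y -> P y z -> P x z) ->
  (forall t, a <= t <= b -> exists2 r, 0 < r & forall s s',
     a <= s -> s <= t -> t <= s' -> s' <= b -> t - r < s -> s' < t + r -> P s s') ->
  P a b.
Proof.
move=> ab Padd Ploc.
pose S := [set x | a <= x <= b /\ P a x].
have Sa : S a.
  split; first by rewrite lexx.
  have [|r r0] := Ploc a; first by rewrite lexx.
  by apply => //; lra.
have Sub : ubound S b by move=> x [] /andP[].
have hsS : has_sup S by split; [exists a|exists b].
have ac : a <= sup S by apply: ub_le_sup => //; exists b.
have cb : sup S <= b by apply: ge_sup => //; exists a.
have [|r r0 Pr] := Ploc (sup S); first by rewrite ac.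
have [x [/andP[ax xb] Pax] rx] := sup_adherent r0 hsS.
have xc : x <= sup S by apply: ub_le_sup; [exists b|split => //; rewrite ax].
(* Half the local radius goes strictly beyond the supremum unless [b] caps it, which forces
   [sup S = b]. *)
pose s' := Num.min b (sup S + r / 2).
have cs' : sup S <= s' by rewrite le_min cb /=; lra.
have s'b : s' <= b by rewrite ge_min lexx.
have Pas' : P a s'.
  apply: (Padd _ x) => //; first by rewrite (le_trans xc).
  by apply: Pr => //; rewrite gt_min; apply/orP; right; lra.
have : s' <= sup S.
  by apply: ub_le_sup; [exists b|split => //; rewrite s'b (le_trans ac)].
rewrite /s' ge_min => /orP[bc|]; last by lra.
suff -> : b = s' by [].
apply/eqP; rewrite eq_le s'b andbT /s' le_min lexx /=; lra.
Qed.

(** Scalar counterpart of [abs_cont_on], which speaks of matrix-valued curves. *)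
Definition abs_cont_fun (R : realType) (a b : R) (u : R -> R) : Prop :=
  forall eps : R, 0 < eps -> exists2 del : R, 0 < del &
    forall (K : nat) (s t : 'I_K -> R),
      (forall k, a <= s k /\ s k <= t k /\ t k <= b) ->
      (forall k l : 'I_K, (k < l)%N -> t k <= s l) ->
      \sum_(k < K) (t k - s k) < del ->
      \sum_(k < K) `|u (t k) - u (s k)| < eps.

(** With lists, joining the families found on two adjacent intervals is mere concatenation, as the
    additivity step of [cousin] requires. *)
Lemma abs_cont_fun_seq (R : realType) (a b : R) (u : R -> R) :
  abs_cont_fun a b u -> forall eps : R, 0 < eps -> exists2 del : R, 0 < del &
    forall l : seq (R * R),
      all (fun p => [&& a <= p.1, p.1 <= p.2 & p.2 <= b]) l ->
      pairwise (fun p q => p.2 <= q.1) l ->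
      \sum_(p <- l) (p.2 - p.1) < del ->
      \sum_(p <- l) `|u p.2 - u p.1| < eps.
Proof.
move=> acu e /acu[del del0 Hdel]; exists del => // l /allP lab lord.
rewrite !(big_nth (0, 0)) !big_mkord; apply: Hdel => [k|k m km].
  by have /and3P[] := lab _ (mem_nth (0, 0) (ltn_ord k)).
by move/(pairwiseP (0, 0)) : lord; apply => //; rewrite inE.
Qed.

(** Both one-sided difference quotients at [t] are below [e] for small steps; adding the increments
    over [[s, t]] and [[t, s']] gives the bound on intervals that straddle [t], the shape that
    [cousin] expects. *)
Lemma derive1_le0_increment (R : realType) (u : R -> R) (t e : R) : 0 < e ->
  derivable u t 1 -> derive1 u t <= 0 ->
  exists2 r, 0 < r & forall s s', s <= t -> t <= s' -> t - r < s -> s' < t + r ->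
    u s' - u s <= e * (s' - s).
Proof.
move=> e0 du; rewrite derive1E => du0.
have := du; rewrite /derivable => /cvgrPdist_lt /(_ e e0) [r /= r0 Hr].
exists r => // s s' st ts' rs rs'.
have key h : h != 0 -> `|h| < r -> `|'D_1 u t - h^-1 * (u (h + t) - u t)| < e.
  move=> h0 hr; have := Hr h; rewrite /= /ball_ /= sub0r normrN => /(_ hr h0).
  by rewrite /shift /= [h%:A]mulr1.
have right : u s' - u t <= e * (s' - t).
  have [->|ne] := eqVneq s' t; first by rewrite !subrr mulr0.
  have h0 : 0 < s' - t by rewrite subr_gt0 lt_neqAle eq_sym ne.
  have := key (s' - t); rewrite (gt_eqF h0) gtr0_norm// subrK => /(_ isT).
  have /[swap] /[apply] : s' - t < r by lra.
  rewrite mulrC ltr_norml => /andP[+ _].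
  set q := _ / _ => q1.
  have -> : u s' - u t = q * (s' - t) by rewrite /q divfK// gt_eqF.
  by rewrite ler_pM2r//; lra.
have left : u t - u s <= e * (t - s).
  have [->|ne] := eqVneq s t; first by rewrite !subrr mulr0.
  have h0 : 0 < t - s by rewrite subr_gt0 lt_neqAle ne.
  have := key (s - t); rewrite subr_eq0 ne -normrN opprB gtr0_norm// subrK => /(_ isT).
  have /[swap] /[apply] : t - s < r by lra.
  rewrite -(opprB t s) invrN mulNr -mulrN opprB mulrC ltr_norml => /andP[+ _].
  set q := _ / _ => q1.
  have -> : u t - u s = q * (t - s) by rewrite /q divfK// gt_eqF.
  by rewrite ler_pM2r//; lra.
lra.
Qed.

Lemma negligible_open_cover (R : realType) (E : set R) (e : R) : 0 < e ->
  (@lebesgue_measure R).-negligible E ->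
  exists U : set R, [/\ open U, E `<=` U & (@lebesgue_measure R U < e%:E)%E].
Proof.
move=> e0 [D [mD D0 ED]].
pose mu : {measure set _ -> \bar R} := @lebesgue_measure R.
have muD : mu D = 0%E by exact: D0.
have muDy : (mu D < +oo)%E by rewrite muD ltry.
have [U [oU DU UDe]] := lebesgue_regularity_outer mD muDy e0.
exists U; split => //; first exact: subset_trans ED DU.
have mU : measurable (U : set (measurableTypeR R)) by exact: open_measurable.
suff : (mu U < e%:E)%E by [].
have -> : mu U = (mu D + mu (U `\` D))%E.
  rewrite -{1}(setDUK DU); apply: measureU => //; [exact: measurableD|exact: setDIK].
by rewrite muD add0e.
Qed.

(** The exceptional null set is covered by an open [U] of measure below the [del] of absolute
    continuity for [e / 2]. Around points of [U] the increment is charged to intervals contained in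
    [U]; around the other points it is at most [e1] times the length. *)
Lemma abs_cont_nonincreasing (R : realType) (u : R -> R) (a b : R) : a <= b ->
  abs_cont_fun a b u ->
  {ae (@lebesgue_measure R), forall t, a < t -> derivable u t 1 /\ derive1 u t <= 0} ->
  u b <= u a.
Proof.
move=> ab acu aeu; suff ube (e : R) : 0 < e -> u b <= u a + e by apply/ler_addgt0Pr.
move=> e0; have e20 : 0 < e / 2 by rewrite divr_gt0.
(* Chosen so that [e1 * (b - a) <= e / 2]; the [+ 1] covers [a = b]. *)
pose e1 : R := e / 2 / (b - a + 1).
have e10 : 0 < e1 by rewrite !divr_gt0//; lra.
have [del del0 Hdel] := abs_cont_fun_seq acu e20.
pose mu : {measure set _ -> \bar R} := @lebesgue_measure R.
have [U [oU EU Udel]] : exists U : set R, [/\ open U,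
    (* The derivative is controlled only for [a < t], so the left endpoint joins the exceptional
       set. *)
    ~` [set t | a < t -> derivable u t 1 /\ derive1 u t <= 0] `|` [set a] `<=` U
    & (mu U < del%:E)%E].
  apply: negligible_open_cover => //; apply: negligibleU => //.
  exists [set a]; split => //; exact: lebesgue_measure_set1.
have mU : measurable (U : set (measurableTypeR R)) by exact: open_measurable.
(* The list [l] holds the intervals charged to [U]: it is empty around a point outside [U] and a
   single interval around a point of [U]. Half-open intervals make the measures in the third clause
   add up exactly under concatenation. *)
pose P x y := a <= x -> y <= b -> exists l : seq (R * R),
  [/\ all (fun p => [&& x <= p.1, p.1 <= p.2 & p.2 <= y]) l,
      pairwise (fun p q => p.2 <= q.1) l,
      ((\sum_(p <- l) (p.2 - p.1))%:E <= mu (U `&` `]x, y]))%E &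
      u y - u x <= e1 * (y - x) + \sum_(p <- l) `|u p.2 - u p.1|].
have Pab : P a b.
  apply: cousin => // [x y z xy yz Pxy Pyz ax zb|t /andP[at_ tb]].
    have [l [l1 l2 l3 l4]] := Pxy ax (le_trans yz zb).
    have [m [m1 m2 m3 m4]] := Pyz (le_trans ax xy) zb.
    exists (l ++ m); split.
    - rewrite all_cat; apply/andP; split.
        apply: sub_all l1 => p /and3P[-> -> /= py]; exact: le_trans yz.
      by apply: sub_all m1 => p /and3P[yp -> ->]; rewrite (le_trans xy).
    - rewrite pairwise_cat l2 m2 !andbT; apply/allrelP => p q.
      move=> /(allP l1)/and3P[_ _ py] /(allP m1)/and3P[yq _ _]; exact: le_trans yq.
    - rewrite big_cat EFinD /=.
      have -> : U `&` `]x, z] = (U `&` `]x, y]) `|` (U `&` `]y, z]).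
        rewrite -setIUr; congr (_ `&` _); apply/seteqP; split => w /=; rewrite !in_itv /=.
          by move=> /andP[xw wz]; have [wy|yw] := leP w y; [left|right];
            rewrite ?xw ?yw ?wy ?wz.
        by case=> /andP[w1 w2]; apply/andP; split; lra.
      rewrite measureU ?leeD//; [exact: measurableI|exact: measurableI|].
      apply/seteqP; split => // w [[_ /=]]; rewrite in_itv /= => /andP[_ wy] [_ /=].
      by rewrite in_itv /= ltNge wy.
    - by rewrite big_cat /=; lra.
  have [Ut|nUt] := pselect (U t).
    have [r /= r0 rU] := oU _ Ut.
    exists r => // s s' as_ st ts' s'b rs rs' _ _.
    exists [:: (s, s')]; rewrite !big_seq1 /=; split => //.
    - by rewrite !lexx (le_trans st ts').
    - rewrite (_ : U `&` _ = `]s, s']%classic).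
        rewrite /mu lebesgue_measure_itv /= lte_fin.
        by have := le_trans st ts'; rewrite le_eqVlt => /predU1P[->|->]; rewrite ?ltxx ?subrr.
      apply/seteqP; split => w; first by case.
      move=> /=; rewrite in_itv /= => /andP[sw ws']; split; last by rewrite sw.
      apply: rU; rewrite /ball_ /= ltr_norml; lra.
    - have : 0 <= e1 * (s' - s) by rewrite mulr_ge0 ?(ltW e10)//; lra.
      by have := ler_norm (u s' - u s); lra.
  have [du du0] : derivable u t 1 /\ derive1 u t <= 0.
    have at1 : a < t.
      rewrite lt_neqAle at_ andbT; apply/eqP => at1.
      by apply: nUt; apply: EU; right => /=.
    apply: contrapT => nt; apply: nUt; apply: EU; left => /=.
    by move=> /(_ at1).
  have [r r0 Hr] := derive1_le0_increment e10 du du0.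
  exists r => // s s' as_ st ts' s'b rs rs' _ _.
  by exists [::]; rewrite !big_nil /= addr0; split => //; exact: Hr.
have [l [l1 l2 l3 l4]] := Pab (lexx _) (lexx _).
have {}l3 : \sum_(p <- l) (p.2 - p.1) < del.
  rewrite -lte_fin; apply: le_lt_trans l3 _; apply: le_lt_trans Udel.
  by apply: le_measure; rewrite ?inE//; [exact: measurableI].
have := Hdel l l1 l2 l3.
have : e1 * (b - a) <= e / 2.
  by rewrite /e1 -mulrA ler_piMr ?divr_ge0 ?(ltW e0)// mulrC ler_pdivrMr ?mul1r; lra.
lra.
Qed.

Lemma abs_cont_fun_dominated (R : realType) (m n : nat) (Y : R -> 'M[R]_(m, n))
    (a b L : R) (u : R -> R) : abs_cont_on a b Y ->
  (forall s t, a <= s -> s <= t -> t <= b ->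
     `|u t - u s| <= L * (`|Y t - Y s| + `|t - s|)) ->
  abs_cont_fun a b u.
Proof.
move=> acY uL e e0.
pose M : R := `|L| + 1; have M0 : 0 < M by rewrite /M ltr_wpDl.
have eM : 0 < e / 2 / M by rewrite !divr_gt0.
have [del del0 Hdel] := acY _ eM.
exists (Num.min del (e / 2 / M)); first by rewrite lt_min del0.
move=> K s t st ord; rewrite lt_min => /andP[sdel sM].
have sY := Hdel K s t st ord sdel.
apply: (@le_lt_trans _ _ (M * (\sum_(k < K) `|Y (t k) - Y (s k)| + \sum_(k < K) (t k - s k)))).
  rewrite -big_split /= mulr_sumr ler_sum// => k _.
  have [ak [sk bk]] := st k.
  apply: le_trans (uL _ _ ak sk bk) _; rewrite [`|t k - s k|]ger0_norm ?subr_ge0//.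
  apply: ler_wpM2r; first by rewrite addr_ge0 ?subr_ge0.
  by have := ler_norm L; rewrite /M; lra.
rewrite [ltRHS](_ : e = M * (e / 2 / M + e / 2 / M)); first by rewrite ltr_pM2l// ltrD.
by field; rewrite gt_eqF.
Qed.

(* False in dimension 0, where [box_vol] is an empty product, hence 1. *)
Lemma null_set0 (R : realType) (m n : nat) : (0 < m)%N -> (0 < n)%N ->
  Defs.null_set (@set0 'M[R]_(m, n)).
Proof.
case: m => // m _; case: n => // n _ e e0; exists (fun=> 0), (fun=> 0); split => // K.
rewrite big1 ?(ltW e0)// => k _; rewrite /box_vol big_ord_recl /= big_ord_recl /=.
by rewrite subrr !mul0r.
Qed.

(** For affine continuous [l], the set where [l] is at most [h y + e] is closed and convex, and by
    continuity of [h] it contains the image under [F] of a small ball around [y]. It therefore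
    contains the Filippov set, here tested with the empty null set; then [e] tends to 0. *)
Lemma filippov_map_le (R : realType) (m n : nat) (F : 'M[R]_(m, n) -> 'M[R]_(m, n))
    (l h : 'M[R]_(m, n) -> R) (y w : 'M[R]_(m, n)) :
  (0 < m)%N -> (0 < n)%N ->
  (forall (t : R) x x', l (t *: x + (1 - t) *: x') = t * l x + (1 - t) * l x') ->
  continuous l -> (forall y', l (F y') <= h y') -> {for y, continuous h} ->
  filippov_map F y w -> l w <= h y.
Proof.
move=> m0 n0 ladd lcont lF hy Fw.
suff H (e : R) : 0 < e -> l w <= h y + e by apply/ler_addgt0Pr.
move=> e0; have := hy => /cvgrPdist_lt /(_ e e0) /nbhs_ballP [r /= r0 Hr].
have /(_ [set x | l x <= h y + e]) := Fw r r0 set0 (@null_set0 R _ _ m0 n0).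
apply; split.
- rewrite (_ : [set x | _] = l @^-1` [set x | x <= h y + e])//.
  by apply: closed_comp => [x _|]; [exact: lcont|exact: closed_le].
- move=> x x' t /= lx lx' /andP[t0 t1]; rewrite ladd.
  have : t * l x <= t * (h y + e) by rewrite ler_wpM2l.
  have : (1 - t) * l x' <= (1 - t) * (h y + e) by rewrite ler_wpM2l// subr_ge0.
  lra.
- move=> _ [y' [yy' _] <-] /=; apply: le_trans (lF y') _.
  by have := Hr y' yy'; rewrite /= ltr_norml; lra.
Qed.

(** * Strongly convex functions *)

Section inner_product.
Variables (R : realType) (d : nat).
Implicit Types u v w : 'rV[R]_d.

(** The norm on matrices is the sup norm, so Euclidean lengths are expressed through [dotr u u]. *)
Definition dotr u v : R := \sum_k u 0 k * v 0 k.

Lemma dotrC u v : dotr u v = dotr v u.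
Proof. by apply: eq_bigr => k _; rewrite mulrC. Qed.

Lemma dotrDl u v w : dotr (u + v) w = dotr u w + dotr v w.
Proof. by rewrite -big_split; apply: eq_bigr => k _; rewrite mxE mulrDl. Qed.

Lemma dotrZl a u v : dotr (a *: u) v = a * dotr u v.
Proof. by rewrite mulr_sumr; apply: eq_bigr => k _; rewrite mxE mulrA. Qed.

Lemma dotrNl u v : dotr (- u) v = - dotr u v.
Proof. by rewrite -scaleN1r dotrZl mulN1r. Qed.

Lemma dotrBl u v w : dotr (u - v) w = dotr u w - dotr v w.
Proof. by rewrite dotrDl dotrNl. Qed.

Lemma dotrDr u v w : dotr w (u + v) = dotr w u + dotr w v.
Proof. by rewrite dotrC dotrDl !(dotrC w). Qed.

Lemma dotrZr a u v : dotr v (a *: u) = a * dotr v u.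
Proof. by rewrite dotrC dotrZl (dotrC v). Qed.

Lemma dotrNr u v : dotr v (- u) = - dotr v u.
Proof. by rewrite dotrC dotrNl (dotrC v). Qed.

Lemma dotrBr u v w : dotr w (u - v) = dotr w u - dotr w v.
Proof. by rewrite dotrDr dotrNr. Qed.

Lemma dotr_sumr (I : finType) (F : I -> 'rV[R]_d) v :
  dotr v (\sum_i F i) = \sum_i dotr v (F i).
Proof.
rewrite /dotr exchange_big; apply: eq_bigr => k _.
by rewrite summxE mulr_sumr.
Qed.

Lemma dotr_suml (I : finType) (F : I -> 'rV[R]_d) v :
  dotr (\sum_i F i) v = \sum_i dotr (F i) v.
Proof. by rewrite dotrC dotr_sumr; apply: eq_bigr => i _; rewrite dotrC. Qed.

Lemma dotr0 v : dotr 0 v = 0.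
Proof. by rewrite -(scale0r v) dotrZl mul0r. Qed.

Lemma dotr_ge0 u : 0 <= dotr u u.
Proof. by apply: sumr_ge0 => k _; rewrite -expr2 sqr_ge0. Qed.

Lemma sqr_coord_le_dotr u k : u 0 k ^+ 2 <= dotr u u.
Proof.
rewrite /dotr (bigD1 k) //= -expr2 lerDl; apply: sumr_ge0 => l _.
by rewrite -expr2 sqr_ge0.
Qed.

(** Expand |e u - v|^2 >= 0 and divide by 2 e. *)
Lemma dotr_young u v (e : R) : 0 < e ->
  dotr u v <= e / 2 * dotr u u + e^-1 / 2 * dotr v v.
Proof.
move=> e0; have := dotr_ge0 (e *: u - v).
rewrite !(dotrBl, dotrBr, dotrZl, dotrZr) (dotrC v u) => H.
have : 0 <= e^-1 / 2 * (e * (e * dotr u u) - e * dotr u v - (e * dotr u v - dotr v v)).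
  by apply: mulr_ge0; [rewrite divr_ge0// invr_ge0 ltW|lra].
suff -> : e^-1 / 2 * (e * (e * dotr u u) - e * dotr u v - (e * dotr u v - dotr v v)) =
    e / 2 * dotr u u + e^-1 / 2 * dotr v v - dotr u v by rewrite subr_ge0.
by field; rewrite gt_eqF.
Qed.

Lemma sqr_dotrD_le u v : dotr (u + v) (u + v) <= 2 * dotr u u + 2 * dotr v v.
Proof.
have := dotr_ge0 (u - v); rewrite !(dotrDl, dotrDr, dotrNl, dotrNr) (dotrC v u); lra.
Qed.

(** [u *m M^T] is the column product M u written as a row. The transpose has to be kept, since
    Hessians are not shown to be symmetric. *)
Lemma dotr_quad (M : 'M[R]_d) u : (u *m M *m u^T) 0 0 = dotr u (u *m M^T).
Proof.
rewrite -mulmxA mxE; apply: eq_bigr => k _; congr (_ * _).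
by rewrite !mxE; apply: eq_bigr => l _; rewrite !mxE mulrC.
Qed.

End inner_product.

(** * Derivatives along curves and the chain rule *)

Section real_derivatives.
Variable R : realType.
Implicit Types (u v : R -> R) (t : R).

Lemma is_derive1_eq u t (du du' : R) : is_derive t 1 u du -> du = du' ->
  is_derive t 1 u du'.
Proof. by move=> ? <-. Qed.

Lemma is_derive1_add u v t (du dv : R) : is_derive t 1 u du -> is_derive t 1 v dv ->
  is_derive t 1 (fun s => u s + v s) (du + dv).
Proof. by move=> ? ?; exact: is_deriveD. Qed.

Lemma is_derive1_sub u v t (du dv : R) : is_derive t 1 u du -> is_derive t 1 v dv ->
  is_derive t 1 (fun s => u s - v s) (du - dv).
Proof. by move=> ? ?; exact: is_deriveB. Qed.

Lemma is_derive1_mul u v t (du dv : R) : is_derive t 1 u du -> is_derive t 1 v dv ->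
  is_derive t 1 (fun s => u s * v s) (du * v t + u t * dv).
Proof.
move=> hu hv; have /is_derive_eq := @is_deriveM R _ u v t 1 du dv hu hv.
by apply; rewrite addrC [_ *: du]mulrC.
Qed.

Lemma is_derive1_scale u t (a du : R) : is_derive t 1 u du ->
  is_derive t 1 (fun s => a * u s) (a * du).
Proof. by move=> ?; exact: (@is_deriveZ _ _ _ u). Qed.

Lemma is_derive1_sum n (h : 'I_n -> R -> R) t (dh : 'I_n -> R) :
  (forall i, is_derive t 1 (h i) (dh i)) ->
  is_derive t 1 (fun s => \sum_i h i s) (\sum_i dh i).
Proof.
move=> hh; rewrite (_ : (fun s => _) = \sum_i h i); first exact: is_derive_sum.
by apply/funext => s; rewrite fct_sumE.
Qed.

End real_derivatives.

Lemma cvg_mx (R : realType) (T : Type) (F : set_system T) {FF : Filter F} (m n : nat)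
    (M : T -> 'M[R]_(m, n)) (L : 'M[R]_(m, n)) :
  (forall i j, M t i j @[t --> F] --> L i j) -> M t @[t --> F] --> L.
Proof.
move=> ML; apply/cvgrPdist_le => e e0; near=> x.
rewrite /Num.Def.normr/= mx_normrE (bigmax_le _ (ltW e0))//= => i _.
rewrite !mxE/=; move: i; near: x; apply: filter_forall => /= i.
exact: ((cvgrPdist_le _ _).1 (ML i.1 i.2)).
Unshelve. all: by end_near. Qed.

Lemma coord_le_norm (R : realType) (m n : nat) (M : 'M[R]_(m, n)) i j :
  `|M i j| <= `|M|.
Proof.
rewrite [leRHS]/Num.Def.normr/= mx_normrE.
by apply: le_trans; last exact: (le_bigmax _ _ (i, j)).
Qed.

Section chain_rule.
Variables (R : realType) (d : nat).

Lemma diff_gradient (f : 'rV[R]_d -> R) (x v : 'rV[R]_d) : differentiable f x ->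
  'd f x v = dotr (gradient f x) v.
Proof.
move=> df; rewrite {1}(row_sum_delta v) linear_sum; apply: eq_bigr => k _.
by rewrite linearZ /= -deriveE// mxE mulrC.
Qed.

Lemma is_derive_gradient (f : 'rV[R]_d -> R) (x : R -> 'rV[R]_d) (t : R) :
  derivable x t 1 -> differentiable f (x t) ->
  is_derive t 1 (fun s => f (x s)) (dotr (gradient f (x t)) (derive1 x t)).
Proof.
move=> dx df; have dfx : differentiable (f \o x) t.
  by apply: differentiable_comp => //; exact/derivable1_diffP.
split; first by exact/derivable1_diffP.
have dx' : differentiable x t by exact/derivable1_diffP.
rewrite -diff_gradient// derive1E (deriveE _ dx').
have -> : (fun s => f (x s)) = f \o x by [].
rewrite (deriveE _ dfx).
by have -> : ('d (f \o x) t : R -> R) = 'd f (x t) \o 'd x t by exact: diff_comp.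
Qed.

Lemma is_derive_hessian (f : 'rV[R]_d -> R) (x : R -> 'rV[R]_d) (t : R) k :
  derivable x t 1 -> differentiable (gradient f) (x t) ->
  is_derive t 1 (fun s => gradient f (x s) 0 k)
    ((derive1 x t *m (hessian f (x t))^T) 0 k).
Proof.
move=> dx df.
have := @is_derive_gradient (fun y => gradient f y 0 k) x t dx.
have -> : (derive1 x t *m (hessian f (x t))^T) 0 k =
  dotr (gradient (fun y => gradient f y 0 k) (x t)) (derive1 x t).
  by rewrite dotrC mxE; apply: eq_bigr => l _; rewrite !mxE.
apply; apply: (@differentiable_comp _ _ _ _ (gradient f) (fun N : 'rV_d => N 0 k)) => //.
exact: differentiable_coord.
Qed.

Lemma is_derive_coord (m n : nat) (x : R -> 'M[R]_(m, n)) (t : R) i j :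
  derivable x t 1 -> is_derive t 1 (fun s => x s i j) (derive1 x t i j).
Proof.
move=> dx; split; first by move/derivable_mxP : dx; apply.
by rewrite derive1E derive_mx// mxE.
Qed.

End chain_rule.

Section strongly_convex.
Variables (R : realType) (d : nat) (f : 'rV[R]_d -> R) (m M : R).
Hypotheses (fC2 : C2 f) (m0 : 0 < m) (mM : m <= M).
Hypothesis (fmM : forall x, loewner_le m%:M (hessian f x) /\
                            loewner_le (hessian f x) M%:M).
Implicit Types x y e : 'rV[R]_d.
Let g := gradient f.

Let M0 : 0 < M := lt_le_trans m0 mM.

Lemma hessian_bounds x e :
  m * dotr e e <= dotr e (e *m (hessian f x)^T) <= M * dotr e e.
Proof.
have quadB (P Q : 'M[R]_d) : (e *m (P - Q) *m e^T) 0 0 =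
    dotr e (e *m P^T) - dotr e (e *m Q^T).
  by rewrite dotr_quad linearB mulmxBr dotrBr.
have [/(_ e) + /(_ e)] := fmM x; rewrite !quadB !tr_scalar_mx !mul_mx_scalar !dotrZr.
by rewrite !subr_ge0 => -> ->.
Qed.

Lemma derivable_line x e (t : R) : derivable (fun s : R => x + s *: e) t 1 /\
  derive1 (fun s : R => x + s *: e) t = e.
Proof.
have Dk i j : is_derive t 1 (fun s : R => (x + s *: e) i j) (e i j).
  rewrite (_ : (fun s => _) = fun s : R => x i j + s * e i j); last first.
    by apply/funext => s; rewrite !mxE.
  have D1 : is_derive t 1 (fun s : R => s) 1 by exact: is_derive_id.
  have Dc (a : R) : is_derive t 1 (fun=> a : R) 0 by exact: is_derive_cst.
  apply: (is_derive1_eq (is_derive1_add (Dc (x i j)) (is_derive1_mul D1 (Dc (e i j))))).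
  by rewrite add0r mul1r mulr0 addr0.
have dl : derivable (fun s : R => x + s *: e) t 1.
  by apply/derivable_mxP => i j; exact: ex_derive.
split => //; rewrite derive1E derive_mx//; apply/matrixP => i j.
by rewrite mxE derive_val.
Qed.

(** Mean value theorem for t -> <e, g(x + t e)>, whose derivative is the quadratic form of the
    Hessian at [e]. *)
Lemma gradient_increment_bounds x e :
  m * dotr e e <= dotr (g (x + e) - g x) e <= M * dotr e e.
Proof.
pose phi (t : R) := \sum_k e 0 k * g (x + t *: e) 0 k.
pose dphi (t : R) := dotr e (e *m (hessian f (x + t *: e))^T).
have Dphi (t : R) : is_derive t 1 phi (dphi t).
  have [dl dle] := derivable_line x e t.
  have Dg k := is_derive_hessian k dl (fC2.2.1 (x + t *: e)).
  have := is_derive1_sum (fun k => is_derive1_scale (e 0 k) (Dg k)).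
  by rewrite dle.
have [|c _] := @MVT_segment R phi dphi 0 1 ler01.
  by apply: derivable_within_continuous => t _; exact: ex_derive.
rewrite subr0 mulr1 => E.
have -> : dotr (g (x + e) - g x) e = dphi c.
  by rewrite -E /phi scale1r scale0r addr0 dotrC dotrBr.
exact: hessian_bounds.
Qed.

(* The increment of f(x + t e) - t <g x, e> - k t^2 |e|^2 / 2 over [0, 1]. *)
Lemma taylor_mvt x e (k : R) : exists2 c : R, 0 <= c <= 1 &
  f (x + e) - f x - dotr (g x) e - k / 2 * dotr e e =
  dotr (g (x + c *: e) - g x) e - k * c * dotr e e.
Proof.
pose psi (t : R) := f (x + t *: e) - t * dotr (g x) e - t * t * (k / 2 * dotr e e).
pose dpsi (t : R) := dotr (g (x + t *: e)) e - dotr (g x) e - k * t * dotr e e.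
have Dpsi (t : R) : is_derive t 1 psi (dpsi t).
  have [dl dle] := derivable_line x e t.
  have D1 : is_derive t 1 (fun s : R => s) 1 by exact: is_derive_id.
  have Dc (a : R) : is_derive t 1 (fun=> a : R) 0 by exact: is_derive_cst.
  have Df := is_derive_gradient dl (fC2.1 (x + t *: e)).
  apply: (is_derive1_eq (is_derive1_sub (is_derive1_sub Df
    (is_derive1_mul D1 (Dc _))) (is_derive1_mul (is_derive1_mul D1 D1) (Dc _)))).
  by rewrite /dpsi dle -/g; field.
have [|c c01] := @MVT_segment R psi dpsi 0 1 ler01.
  by apply: derivable_within_continuous => t _; exact: ex_derive.
rewrite subr0 mulr1 => E; exists c; first by rewrite in_itv in c01.
rewrite dotrBl -/(dpsi c) -E /psi scale1r scale0r addr0; ring.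
Qed.

(** Taking [k = m] and then [k = M] in [taylor_mvt] gives the mean-value remainder a definite sign,
    by monotonicity of the gradient along the segment. *)
Lemma bregman_bounds x e :
  m / 2 * dotr e e <= f (x + e) - f x - dotr (g x) e <= M / 2 * dotr e e.
Proof.
have scaled (c : R) : 0 <= c ->
    m * c * dotr e e <= dotr (g (x + c *: e) - g x) e <= M * c * dotr e e.
  (* The bound at [c *: e] carries one factor [c] too many; it is divided out, so [c = 0] is settled
     apart. *)
  rewrite le_eqVlt => /predU1P[<-|c0].
    by rewrite scale0r addr0 subrr dotr0 !mulr0 !mul0r lexx.
  have := gradient_increment_bounds x (c *: e); rewrite !(dotrZl, dotrZr).
  have E (k : R) : k * (c * (c * dotr e e)) = c * (k * c * dotr e e) by ring.
  by rewrite !E !ler_pM2l.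
have [c /andP[c0 _] E] := taylor_mvt x e m.
have [c' /andP[c0' _] E'] := taylor_mvt x e M.
have /andP[] := scaled _ c0; have /andP[] := scaled _ c0'.
lra.
Qed.

(** Compare the values at y - M^-1 (g y - g x), the gradient step from [y] for f - <g x, .>:
    convexity at [x] bounds f there from below, the quadratic upper bound at [y] from above. *)
Lemma bregman_gradient x y :
  M^-1 / 2 * dotr (g y - g x) (g y - g x) <= f y - f x - dotr (g x) (y - x).
Proof.
have /andP[H1 _] := bregman_bounds x (y - x - M^-1 *: (g y - g x)).
have /andP[_ H2] := bregman_bounds y (- (M^-1 *: (g y - g x))).
have yE : x + (y - x - M^-1 *: (g y - g x)) = y + - (M^-1 *: (g y - g x)).
  by rewrite addrA (addrC x) subrK.
have {H1} H1 : 0 <= f (y + - (M^-1 *: (g y - g x))) - f x -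
    dotr (g x) (y - x - M^-1 *: (g y - g x)).
  by rewrite -yE (le_trans _ H1)// mulr_ge0 ?dotr_ge0// divr_ge0// ltW.
have D1 : dotr (g x) (y - x - M^-1 *: (g y - g x)) =
    dotr (g x) (y - x) - M^-1 * dotr (g x) (g y - g x) by rewrite (dotrBr (y - x)) dotrZr.
have D2 : dotr (g y) (- (M^-1 *: (g y - g x))) = - (M^-1 * dotr (g y) (g y - g x)).
  by rewrite dotrNr dotrZr.
have D3 : M / 2 * dotr (- (M^-1 *: (g y - g x))) (- (M^-1 *: (g y - g x))) =
    M^-1 / 2 * dotr (g y - g x) (g y - g x).
  by rewrite dotrNl dotrNr dotrZl dotrZr; field; rewrite gt_eqF.
have D4 : M^-1 * dotr (g y - g x) (g y - g x) =
    M^-1 * dotr (g y) (g y - g x) - M^-1 * dotr (g x) (g y - g x).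
  by rewrite -mulrBr -dotrBl.
rewrite D1 in H1; rewrite D2 D3 in H2.
move: H1 H2 D4; set r := dotr (g x) (y - x); set p := _ * dotr (g y) _.
set q := M^-1 * dotr (g x) _; set D := dotr (g y - g x) (g y - g x).
rewrite -[M^-1 / 2 * D]mulrA (mulrC 2^-1) mulrA; lra.
Qed.

(** The Baillon-Haddad inequality: add [bregman_gradient] for (x, y) and for (y, x). *)
Lemma gradient_cocoercive x y :
  dotr (g y - g x) (g y - g x) <= M * dotr (g y - g x) (y - x).
Proof.
have H1 := bregman_gradient x y; have H2 := bregman_gradient y x.
have D1 : dotr (g x - g y) (g x - g y) = dotr (g y - g x) (g y - g x).
  by rewrite -(opprB (g y) (g x)) dotrNl dotrNr opprK.
have D2 : dotr (g y) (x - y) = - dotr (g y) (y - x) by rewrite -dotrNr opprB.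
rewrite D1 D2 in H2; rewrite -ler_pdivrMl// (dotrBl (g y) _ (y - x)).
move: H1 H2; set D := dotr (g y - g x) (g y - g x).
rewrite -[M^-1 / 2 * D]mulrA (mulrC 2^-1) mulrA; lra.
Qed.

Lemma gradient_lipschitz x y :
  dotr (g y - g x) (g y - g x) <= M ^+ 2 * dotr (y - x) (y - x).
Proof.
have := gradient_cocoercive x y.
have := dotr_young (g y - g x) (M *: (y - x)) ltr01.
rewrite !(dotrZl, dotrZr) invr1; lra.
Qed.

(** A row [u] of the left kernel satisfies m |u|^2 <= u H u^T = 0. *)
Lemma hessian_unitmx x : hessian f x \in unitmx.
Proof.
rewrite -row_free_unit -kermx_eq0; apply/eqP/row_matrixP => i.
rewrite row0; set u := row i _.
have uH : u *m hessian f x = 0 by rewrite -row_mul mulmx_ker row0.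
have : m * dotr u u <= 0.
  have /andP[H _] := hessian_bounds x u; apply: le_trans H _.
  by rewrite -dotr_quad uH mul0mx mxE.
rewrite pmulr_rle0// => u0.
apply/rowP => k; rewrite [RHS]mxE; apply/eqP; rewrite -sqrf_eq0 eq_le sqr_ge0 andbT.
exact: le_trans (sqr_coord_le_dotr _ _) u0.
Qed.

End strongly_convex.

(** * Functions with increments controlled by a curve and by time *)

Section dominated_functions.
Variables (R : realType) (m n : nat) (Y : R -> 'M[R]_(m, n)) (a b : R).
Implicit Types u v : R -> R.

(** A pointwise Lipschitz bound, so stability properties need no families of intervals. The term
    [|t - s|] admits time factors such as [1 + c * t]. *)
Definition dominated u := exists L : R, forall s t, a <= s -> s <= t -> t <= b ->
  `|u t - u s| <= L * (`|Y t - Y s| + `|t - s|).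

Lemma dominated_cst (c : R) : dominated (fun=> c).
Proof. by exists 0 => s t *; rewrite subrr normr0 mul0r. Qed.

Lemma dominated_id : dominated id.
Proof. by exists 1 => s t *; rewrite mul1r lerDr. Qed.

Lemma dominated_coord i j : dominated (fun t => Y t i j).
Proof.
exists 1 => s t *; rewrite mul1r; apply: (@le_trans _ _ `|Y t - Y s|).
  by have := coord_le_norm (Y t - Y s) i j; rewrite !mxE.
by rewrite lerDl.
Qed.

Lemma dominated_add u v : dominated u -> dominated v -> dominated (fun t => u t + v t).
Proof.
move=> [L Lu] [L' Lv]; exists (L + L') => s t as_ st tb.
have := Lu _ _ as_ st tb; have := Lv _ _ as_ st tb.
rewrite opprD addrACA mulrDl => h1 h2.
by apply: le_trans (ler_normD _ _) _; exact: lerD.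
Qed.

Lemma dominated_scale (c : R) u : dominated u -> dominated (fun t => c * u t).
Proof.
move=> [L Lu]; exists (`|c| * L) => s t as_ st tb.
by rewrite -mulrBr normrM -mulrA ler_wpM2l// Lu.
Qed.

Lemma dominated_sub u v : dominated u -> dominated v -> dominated (fun t => u t - v t).
Proof.
move=> hu /(dominated_scale (-1)) hv.
have := dominated_add hu hv; congr dominated; apply/funext => t.
by rewrite mulN1r.
Qed.

Lemma dominated_sum (I : finType) (u : I -> R -> R) :
  (forall i, dominated (u i)) -> dominated (fun t => \sum_i u i t).
Proof.
move=> hu; elim: (index_enum I) => [|i s ih].
  by under eq_fun do rewrite big_nil; exact: dominated_cst.
by under eq_fun do rewrite big_cons; exact: dominated_add.
Qed.

Hypotheses (ab : a <= b) (acY : abs_cont_on a b Y).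

(** Absolute continuity with tolerance 1 bounds the oscillation on short intervals, and bounds on
    adjacent intervals glue. The product rule for dominated functions rests on this. *)
Lemma abs_cont_on_bounded : exists B : R, forall t, a <= t <= b -> `|Y t| <= B.
Proof.
have [del del0 Hdel] := acY ltr01.
have osc s t : a <= s -> s <= t -> t <= b -> t - s < del -> `|Y t - Y s| < 1.
  move=> as_ st tb tsd; have := Hdel 1%N (fun=> s) (fun=> t).
  rewrite !big_ord1; apply => // k l; by rewrite !ord1.
pose P x y := a <= x -> y <= b -> exists B : R, forall t, x <= t <= y -> `|Y t| <= B.
suff : P a b by apply.
apply: cousin => // [x y z xy yz Pxy Pyz ax zb|t /andP[at_ tb]].
  have [B HB] := Pxy ax (le_trans yz zb); have [B' HB'] := Pyz (le_trans ax xy) zb.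
  exists (Num.max B B') => t /andP[xt tz]; rewrite le_max.
  by have [ty|yt] := leP t y; [rewrite HB ?xt|rewrite HB' ?orbT ?(ltW yt)].
exists (del / 2) => [|s s' as_ st ts' s'b rs rs' _ _]; first by rewrite divr_gt0.
exists (`|Y s| + 1) => w /andP[sw ws'].
rewrite -[Y w](subrK (Y s)) addrC (le_trans (ler_normD _ _))// lerD2l ltW//.
by apply: osc => //; lra.
Qed.

Lemma dominated_bounded u : dominated u ->
  exists B : R, 0 <= B /\ forall t, a <= t <= b -> `|u t| <= B.
Proof.
move=> [L Lu]; have [B HB] := abs_cont_on_bounded.
have B0 : 0 <= B by apply: le_trans (normr_ge0 (Y a)) _; rewrite HB ?lexx.
exists (`|u a| + `|L| * (B + B + (b - a))); split.
  by apply: addr_ge0 => //; apply: mulr_ge0 => //; rewrite addr_ge0 ?subr_ge0 ?addr_ge0.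
move=> t /andP[at_ tb]; rewrite -[u t](subrK (u a)) addrC.
rewrite (le_trans (ler_normD _ _))// lerD2l.
apply: le_trans (Lu _ _ (lexx _) at_ tb) _.
have rho0 : 0 <= `|Y t - Y a| + `|t - a| by rewrite addr_ge0.
apply: (@le_trans _ _ (`|L| * (`|Y t - Y a| + `|t - a|))).
  by rewrite ler_wpM2r// ler_norm.
apply: ler_wpM2l => //; apply: lerD; last by rewrite ger0_norm; lra.
by rewrite (le_trans (ler_normB _ _))// lerD// HB ?lexx ?at_.
Qed.

Lemma dominated_mul u v : dominated u -> dominated v -> dominated (fun t => u t * v t).
Proof.
move=> hu hv; have [B [B0 HB]] := dominated_bounded hu.
have [B' [B'0 HB']] := dominated_bounded hv.
have [L Lu] := hu; have [L' Lv] := hv.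
exists (B * L' + B' * L) => s t as_ st tb.
have -> : u t * v t - u s * v s = u t * (v t - v s) + v s * (u t - u s) by ring.
apply: le_trans (ler_normD _ _) _; rewrite !normrM mulrDl -!mulrA.
apply: lerD; apply: ler_pM => //.
- by rewrite HB// tb andbT (le_trans as_).
- exact: Lv.
- by rewrite HB'// as_ (le_trans st).
- exact: Lu.
Qed.

End dominated_functions.

(** The factor [d] instead of its square root is cruder but avoids roots. *)
Lemma sqr_dotr_le_norm (R : realType) (d : nat) (e : 'rV[R]_d) :
  dotr e e <= (d%:R * `|e|) ^+ 2.
Proof.
apply: (@le_trans _ _ (\sum_(k < d) `|e| ^+ 2)).
  apply: ler_sum => k _; rewrite -expr2 -[leLHS]real_normK ?num_real//.
  by rewrite lerXn2r ?nnegrE// coord_le_norm.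
rewrite sumr_const card_ord -[leLHS]mulr_natl exprMn; apply: ler_wpM2r; rewrite ?sqr_ge0//.
by case: d e => [|d] e; rewrite ?expr0n// -natrX ler_nat leq_pmull.
Qed.

Section dominated_composition.
Variables (R : realType) (d m n : nat) (f : 'rV[R]_d -> R) (mlo mhi : R).
Hypotheses (fC2 : C2 f) (m0 : 0 < mlo) (mM : mlo <= mhi).
Hypothesis (fmM : forall x, loewner_le mlo%:M (hessian f x) /\
                            loewner_le (hessian f x) mhi%:M).
Variables (Y : R -> 'M[R]_(m, n)) (a b : R) (x : R -> 'rV[R]_d).
Hypotheses (ab : a <= b) (acY : abs_cont_on a b Y).
Hypothesis (xY : forall s t, `|x t - x s| <= `|Y t - Y s|).

Let M0 : 0 < mhi := lt_le_trans m0 mM.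

Lemma dominated_row k : dominated Y a b (fun t => x t 0 k).
Proof.
exists 1 => s t *; rewrite mul1r.
have := coord_le_norm (x t - x s) 0 k; rewrite !mxE => /le_trans; apply.
by rewrite (le_trans (xY _ _))// lerDl.
Qed.

Lemma dominated_gradient k : dominated Y a b (fun t => gradient f (x t) 0 k).
Proof.
exists (mhi * d%:R) => s t _ _ _.
apply: (@le_trans _ _ (mhi * (d%:R * `|x t - x s|))).
  rewrite -(@ler_sqr R) ?nnegrE ?mulr_ge0 ?(ltW M0)// real_normK ?num_real//.
  have := sqr_coord_le_dotr (gradient f (x t) - gradient f (x s)) k.
  rewrite !mxE => /le_trans; apply.
  apply: le_trans (gradient_lipschitz fC2 m0 mM fmM _ _) _.
  by rewrite exprMn ler_wpM2l ?sqr_ge0// sqr_dotr_le_norm.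
rewrite -mulrA ler_wpM2l ?(ltW M0)// ler_wpM2l// (le_trans (xY _ _))// lerDl//.
Qed.

(** Convexity at both ends puts f(x t) - f(x s) between <g(x s), x t - x s> and <g(x t), x t - x s>,
    and the gradient is bounded along the curve. *)
Lemma dominated_fun : dominated Y a b (fun t => f (x t)).
Proof.
have dB k : exists B : R, 0 <= B /\
    forall t, a <= t <= b -> `|gradient f (x t) 0 k| <= B.
  by apply: (dominated_bounded ab acY); exact: dominated_gradient.
have /choice[B HB] := dB.
have dot_le s t r : a <= r <= b ->
    `|dotr (gradient f (x r)) (x t - x s)| <= (\sum_k B k) * `|x t - x s|.
  move=> rab; rewrite mulr_suml; apply: le_trans (ler_norm_sum _ _ _) _.
  apply: ler_sum => k _; rewrite normrM; apply: ler_pM => //.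
    exact: (HB k).2.
  exact: coord_le_norm.
exists (\sum_k B k) => s t as_ st tb.
have dY : (\sum_k B k) * `|x t - x s| <= (\sum_k B k) * (`|Y t - Y s| + `|t - s|).
  apply: ler_wpM2l; first by apply: sumr_ge0 => k _; exact: (HB k).1.
  by rewrite (le_trans (xY _ _))// lerDl.
have /andP[lo _] := bregman_bounds fC2 fmM (x s) (x t - x s).
have /andP[up _] := bregman_bounds fC2 fmM (x t) (x s - x t).
have q1 : 0 <= mlo / 2 * dotr (x t - x s) (x t - x s).
  by rewrite mulr_ge0 ?dotr_ge0// divr_ge0// ltW.
have q2 : 0 <= mlo / 2 * dotr (x s - x t) (x s - x t).
  by rewrite mulr_ge0 ?dotr_ge0// divr_ge0// ltW.
have E1 : x s + (x t - x s) = x t by rewrite addrC subrK.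
have E2 : x t + (x s - x t) = x s by rewrite addrC subrK.
have E3 : dotr (gradient f (x t)) (x s - x t) = - dotr (gradient f (x t)) (x t - x s).
  by rewrite -dotrNr opprB.
rewrite E1 in lo; rewrite E2 E3 in up.
have sab : a <= s <= b by rewrite as_ (le_trans st).
have tab : a <= t <= b by rewrite tb (le_trans as_).
have := dot_le s t s sab; have := dot_le s t t tab; rewrite !ler_norml.
move=> /andP[h1 h2] /andP[h3 h4]; apply/andP; split; lra.
Qed.

End dominated_composition.

(** * Summation by parts and a Poincare inequality on the graph *)

Section graph.
Variables (R : realType) (N d : nat) (A : 'M[R]_N).
Hypothesis (adjA : is_adjacency A).
Implicit Types X : 'I_N -> 'rV[R]_d.

(** Ordered pairs count each edge twice, so [2^-1 * dirichlet X] is the Laplacian form <X, L X>. *)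
Definition dirichlet X : R := \sum_i \sum_j A i j * dotr (X i - X j) (X i - X j).

Lemma adjacency_ge0 i j : 0 <= A i j.
Proof. by case: (adjA.1 i j) => ->. Qed.

(** Exchange [i] and [j] in the double sum and average, using the symmetry of [A]. *)
Lemma sum_adjacency_antisym (u : 'I_N -> 'rV[R]_d) (w : 'I_N -> 'I_N -> 'rV[R]_d) :
  (forall i j, w j i = - w i j) ->
  \sum_i dotr (u i) (\sum_j A i j *: w i j) =
  2^-1 * \sum_i \sum_j A i j * dotr (u i - u j) (w i j).
Proof.
move=> anti; pose S := \sum_i \sum_j A i j * dotr (u i) (w i j).
have -> : \sum_i dotr (u i) (\sum_j A i j *: w i j) = S.
  apply: eq_bigr => i _; rewrite dotr_sumr; apply: eq_bigr => j _.
  by rewrite dotrZr.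
have -> : \sum_i \sum_j A i j * dotr (u i - u j) (w i j) = S + S.
  rewrite {2}/S [X in _ = _ + X]exchange_big /= -big_split; apply: eq_bigr => i _ /=.
  rewrite -big_split; apply: eq_bigr => j _ /=.
  by rewrite (adjA.2.1 j i) (anti i j) dotrBl dotrNr mulrBr mulrN.
by field.
Qed.

Lemma dirichlet_ge0 X : 0 <= dirichlet X.
Proof.
by apply: sumr_ge0 => i _; apply: sumr_ge0 => j _; rewrite mulr_ge0 ?dotr_ge0 ?adjacency_ge0.
Qed.

Lemma edge_le_dirichlet X i j : A i j = 1 ->
  dotr (X i - X j) (X i - X j) <= dirichlet X.
Proof.
move=> Aij; rewrite /dirichlet (bigD1 i) //= (bigD1 j) //= Aij mul1r -addrA lerDl.
rewrite addr_ge0//; first apply: sumr_ge0 => k _; last apply: sumr_ge0 => k _.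
  by rewrite mulr_ge0 ?dotr_ge0 ?adjacency_ge0.
by apply: sumr_ge0 => l _; rewrite mulr_ge0 ?dotr_ge0 ?adjacency_ge0.
Qed.

(** A path from [i] to [j] telescopes the difference into edge differences, each controlled by the
    Dirichlet sum. The constant depends on the path only, hence not on [X]. *)
Lemma connected_poincare : graph_connected A -> exists C : R, 0 <= C /\
  forall X i j, dotr (X i - X j) (X i - X j) <= C * dirichlet X.
Proof.
move=> conA.
have pathC p : forall i, path [rel a b | A a b == 1] i p -> exists C : R, 0 <= C /\
    forall X, dotr (X i - X (last i p)) (X i - X (last i p)) <= C * dirichlet X.
  elim: p => [|k p ih] i /=.
    by move=> _; exists 0; split => // X; rewrite subrr dotr0 mul0r.
  (* From |a + b|^2 <= 2 |a|^2 + 2 |b|^2: one edge, then the rest of the path. *)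
  move=> /andP[/eqP Aik /ih[C [C0 HC]]]; exists (2 + 2 * C); split.
    by rewrite addr_ge0// mulr_ge0.
  move=> X; rewrite -(subrKA (X k)); apply: le_trans (sqr_dotrD_le _ _) _.
  by have := edge_le_dirichlet X Aik; have := HC X; lra.
have /choice[C HC] : forall ij : 'I_N * 'I_N, exists C : R, 0 <= C /\
    forall X, dotr (X ij.1 - X ij.2) (X ij.1 - X ij.2) <= C * dirichlet X.
  by move=> [i j]; have /connectP[p /pathC[C HC] ->] := conA i j; exists C.
(* The sum of the nonnegative constants serves all pairs at once. *)
exists (\sum_ij C ij); split; first by apply: sumr_ge0 => ij _; exact: (HC ij).1.
move=> X i j; apply: le_trans ((HC (i, j)).2 X) _; apply: ler_wpM2r.
  exact: dirichlet_ge0.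
by rewrite (bigD1 (i, j)) //= lerDl; apply: sumr_ge0 => ij _; exact: (HC ij).1.
Qed.

End graph.

(** * Continuity of the matrix inverse *)

Section matrix_inverse.
Variables (R : realType) (T : Type) (F : set_system T).
Context {FF : Filter F}.

Lemma cvg_det n (M : T -> 'M[R]_n) (L : 'M[R]_n) :
  (forall i j, M t i j @[t --> F] --> L i j) -> \det (M t) @[t --> F] --> \det L.
Proof.
move=> ML; apply: cvg_big => [|s _]; first exact: add_continuous.
apply: cvgM; first exact: cvg_cst.
by apply: cvg_big => [|i _]; [exact: mul_continuous|exact: ML].
Qed.

(** On a singular matrix [invmx] returns the matrix itself, so invertibility is asked everywhere;
    the cofactor formula then reduces the claim to determinants. *)
Lemma cvg_invmx n (M : T -> 'M[R]_n) (L : 'M[R]_n) :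
  (forall t, M t \in unitmx) -> L \in unitmx ->
  (forall i j, M t i j @[t --> F] --> L i j) ->
  forall i j, invmx (M t) i j @[t --> F] --> invmx L i j.
Proof.
move=> uM uL ML i j.
have invE (B : 'M[R]_n) : B \in unitmx -> invmx B i j = (\det B)^-1 * cofactor B j i.
  by move=> uB; rewrite /invmx uB !mxE.
rewrite invE//; under eq_fun do rewrite invE//.
apply: cvgM.
  by apply: cvgV; [rewrite -unitfE|exact: cvg_det].
apply: cvgM; first exact: cvg_cst.
apply: cvg_det => k l; under eq_fun do rewrite !mxE.
rewrite !mxE; exact: ML.
Qed.

End matrix_inverse.

(** * Filippov inclusion for the HISO field *)

Lemma cvg_dotr (R : realType) (d : nat) (T : Type) (F : set_system T)
    {FF : Filter F} (u v : T -> 'rV[R]_d)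
    (a b : 'rV[R]_d) :
  u t @[t --> F] --> a -> v t @[t --> F] --> b -> dotr (u t) (v t) @[t --> F] --> dotr a b.
Proof.
move=> ua vb; apply: cvg_big => [|k _]; first exact: add_continuous.
apply: cvgM.
  exact: (@continuous_cvg _ _ _ _ _ u (fun e : 'rV[R]_d => e 0 k) a
    (@coord_continuous R _ _ 0 k a) ua).
exact: (@continuous_cvg _ _ _ _ _ v (fun e : 'rV[R]_d => e 0 k) b
    (@coord_continuous R _ _ 0 k b) vb).
Qed.

Section hiso_filippov.
Variables (R : realType) (N d : nat) (A : 'M[R]_N) (f : 'I_N -> 'rV[R]_d -> R).
Variables (mlo mhi : 'I_N -> R).
Hypotheses (adjA : is_adjacency A) (fC2 : forall i, C2 (f i)).
Hypothesis (mlohi : forall i, 0 < mlo i /\ mlo i <= mhi i).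
Hypothesis (fmM : forall i x, loewner_le (mlo i)%:M (hessian (f i) x) /\
                              loewner_le (hessian (f i) x) (mhi i)%:M).
Hypotheses (N0 : (0 < N)%N) (d0 : (0 < d)%N).
Implicit Types y w : 'M[R]_(N + N, d).
Local Notation xof y i := (row i (usubmx y)).
Local Notation vof y i := (row i (dsubmx y)).
Local Notation z := (hiso_z f).
Local Notation lap := (hiso_lap A).
Local Notation F := (hiso_field A f).

Let NN0 : (0 < N + N)%N. Proof. by rewrite addn_gt0 N0. Qed.

Lemma row_usubmxE y i k : (xof y i) 0 k = y (lshift N i) k.
Proof. by rewrite !mxE. Qed.

Lemma row_dsubmxE y i k : (vof y i) 0 k = y (rshift N i) k.
Proof. by rewrite !mxE. Qed.

(* The filter is abstract because unification unfolds [nbhs] on matrices. *)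
Section continuity.
Variables (G : set_system 'M[R]_(N + N, d)) (y : 'M[R]_(N + N, d)).
Context {FG : Filter G}.
Hypothesis (Gy : forall i k, (fun y' : 'M[R]_(N + N, d) => y' i k) @ G --> y i k).

Lemma cvg_row_usubmx i : xof y' i @[y' --> G] --> xof y i.
Proof.
apply: cvg_mx => o k; rewrite ord1 row_usubmxE.
by under eq_fun do rewrite row_usubmxE; exact: Gy.
Qed.

Lemma cvg_row_dsubmx i : vof y' i @[y' --> G] --> vof y i.
Proof.
apply: cvg_mx => o k; rewrite ord1 row_dsubmxE.
by under eq_fun do rewrite row_dsubmxE; exact: Gy.
Qed.

Lemma cvg_hiso_z i : z y' i @[y' --> G] --> z y i.
Proof.
apply: cvgD; last exact: cvg_row_dsubmx.
apply: (@continuous_cvg _ _ _ _ _ _ (gradient (f i))); last exact: cvg_row_usubmx.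
exact: differentiable_continuous ((fC2 i).2.1 _).
Qed.

Lemma cvg_hiso_lap i : lap y' i @[y' --> G] --> lap y i.
Proof.
apply: cvg_big => [|j _]; first exact: add_continuous.
by apply: cvgZl_tmp; apply: cvgB; exact: cvg_row_usubmx.
Qed.

Lemma cvg_hiso_xdot i k : hiso_xdot A f y' i 0 k @[y' --> G] --> hiso_xdot A f y i 0 k.
Proof.
have E y' : hiso_xdot A f y' i 0 k =
    - \sum_l invmx (hessian (f i) (xof y' i)) k l * (z y' i + lap y' i) 0 l.
  by rewrite 3!mxE; congr (- _); apply: eq_bigr => l _; rewrite [in LHS]mxE.
rewrite E; under eq_fun do rewrite E.
have [mlo0 mloh] := mlohi i.
apply: cvgN; apply: cvg_big => [|l _]; first exact: add_continuous.
apply: cvgM.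
  apply: cvg_invmx.
  - by move=> y'; exact: (hessian_unitmx mlo0 (fmM i)).
  - exact: (hessian_unitmx mlo0 (fmM i)).
  - move=> a b.
    apply: (@continuous_cvg _ _ _ _ _ _ (fun H : 'M[R]_d => H a b));
      first exact: coord_continuous.
    by apply: (@continuous_cvg _ _ _ _ _ _ (hessian (f i)));
      [exact: (fC2 i).2.2|exact: cvg_row_usubmx].
apply: (@continuous_cvg _ _ _ _ _ _ (fun e : 'rV[R]_d => e 0 l));
  first exact: coord_continuous.
by apply: cvgD; [exact: cvg_hiso_z|exact: cvg_hiso_lap].
Qed.

Lemma cvg_sum_dotr (u : 'I_N -> 'rV[R]_d) (v : 'M[R]_(N + N, d) -> 'I_N -> 'rV[R]_d) :
  (forall i, v y' i @[y' --> G] --> v y i) ->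
  \sum_i dotr (u i) (v y' i) @[y' --> G] --> \sum_i dotr (u i) (v y i).
Proof.
move=> vG; apply: cvg_big => [|i _]; first exact: add_continuous.
by apply: cvg_dotr; [exact: cvg_cst|exact: vG].
Qed.

Lemma cvg_sum_gap (p : 'I_N -> 'I_N -> 'rV[R]_d) :
  \sum_i \sum_j A i j * (\sum_k `|p i j 0 k - (z y' i - z y' j) 0 k|) @[y' --> G] -->
  \sum_i \sum_j A i j * (\sum_k `|p i j 0 k - (z y i - z y j) 0 k|).
Proof.
apply: cvg_big => [|i _]; first exact: add_continuous.
apply: cvg_big => [|j _]; first exact: add_continuous.
apply: cvgM; first exact: cvg_cst.
apply: cvg_big => [|k _]; first exact: add_continuous.
apply: cvg_norm; apply: cvgB; first exact: cvg_cst.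
apply: (@continuous_cvg _ _ _ _ _ _ (fun e : 'rV[R]_d => e 0 k));
  first exact: coord_continuous.
by apply: cvgB; exact: cvg_hiso_z.
Qed.

End continuity.

Let cvg_coord y i k : (fun y' : 'M[R]_(N + N, d) => y' i k) @ nbhs y --> y i k.
Proof. exact: coord_continuous. Qed.

Lemma hiso_field_x y i : (xof (F y) i) = hiso_xdot A f y i.
Proof. by rewrite /hiso_field col_mxKu rowK. Qed.

Lemma hiso_field_v y i : (vof (F y) i) = hiso_vdot A f y i.
Proof. by rewrite /hiso_field col_mxKd rowK. Qed.

(** This block of the field is continuous; bounding each coordinate and its opposite by themselves
    leaves a single possible value. *)
Lemma filippov_hiso_x y w i : filippov_map F y w -> (xof w i) = hiso_xdot A f y i.
Proof.
move=> yw; apply/rowP => k.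
have FE y' : F y' (lshift N i) k = hiso_xdot A f y' i 0 k.
  by rewrite -hiso_field_x row_usubmxE.
rewrite row_usubmxE; apply/eqP; rewrite eq_le; apply/andP; split.
  apply: (@filippov_map_le R _ _ F (fun w => w (lshift N i) k)
    (fun y => hiso_xdot A f y i 0 k)) yw => //.
  - by move=> t x x'; rewrite !mxE.
  - exact: coord_continuous.
  - by move=> y'; rewrite FE.
  - exact: (@cvg_hiso_xdot (nbhs y) y _ (@cvg_coord y)).
rewrite -lerN2; apply: (@filippov_map_le R _ _ F (fun w => - w (lshift N i) k)
    (fun y => - hiso_xdot A f y i 0 k)) yw => //.
- by move=> t x x'; rewrite !mxE; ring.
- by move=> y'; apply: (@cvgN _ _ _ (nbhs y')); exact: coord_continuous.
- by move=> y'; rewrite FE.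
- by apply: (@cvgN _ _ _ (nbhs y)); exact: (@cvg_hiso_xdot (nbhs y) y _ (@cvg_coord y)).
Qed.

Lemma filippov_hiso_hessian y w i : filippov_map F y w ->
  (xof w i) *m (hessian (f i) (xof y i))^T = - (z y i + lap y i).
Proof.
move=> /filippov_hiso_x ->; have [mlo0 _] := mlohi i.
rewrite /hiso_xdot mulNmx -trmx_mul mulmxA mulmxV ?mul1mx ?trmxK//.
exact: (hessian_unitmx mlo0 (fmM i)).
Qed.

Lemma sgn_vecN (u : 'rV[R]_d) : sgn_vec (- u) = - sgn_vec u.
Proof. by apply/rowP => k; rewrite !mxE sgrN. Qed.

(** Both effects of an edge on [v^i], grouped because their antisymmetry is what conserves the sum
    of the [v^i]. *)
Let coupling y i j := - sgn_vec (z y i - z y j) + ((xof y i) - (xof y j)).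

Lemma hiso_vdotE y i : hiso_vdot A f y i = \sum_j A i j *: coupling y i j.
Proof.
rewrite /hiso_vdot -sumrN -big_split; apply: eq_bigr => j _ /=.
by rewrite [RHS]scalerDr scalerN.
Qed.

Lemma coupling_antisym y i j : coupling y j i = - coupling y i j.
Proof.
rewrite /coupling -(opprB (z y i) (z y j)) -(opprB (xof y i) (xof y j)) sgn_vecN.
by rewrite [RHS]opprD.
Qed.

Lemma sum_hiso_vdot y (u : 'I_N -> 'rV[R]_d) :
  \sum_i dotr (u i) (vof (F y) i) = \sum_i dotr (u i) (lap y i) -
    2^-1 * \sum_i \sum_j A i j * dotr (u i - u j) (sgn_vec (z y i - z y j)).
Proof.
under eq_bigr do rewrite hiso_field_v dotrDr; rewrite big_split addrC; congr (_ + _).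
rewrite -sum_adjacency_antisym//; last by move=> i j; rewrite -(opprB (z y i)) sgn_vecN.
by rewrite -sumrN; apply: eq_bigr => i _; rewrite dotrNr.
Qed.

(** The vectors [u] are constants here, so the functional is linear; state-dependent weights are
    frozen at [y] before use. *)
Lemma filippov_hiso_v y w (u : 'I_N -> 'rV[R]_d) (h : 'M[R]_(N + N, d) -> R) :
  (forall y', \sum_i dotr (u i) (vof (F y') i) <= h y') -> {for y, continuous h} ->
  filippov_map F y w -> \sum_i dotr (u i) (vof w i) <= h y.
Proof.
move=> Fh hy; apply: (@filippov_map_le R _ _ F (fun w => \sum_i dotr (u i) (vof w i))) => //.
- move=> t x x'; rewrite !mulr_sumr -big_split; apply: eq_bigr => i _ /=.
  by rewrite !linearD !linearZ /= dotrDr !dotrZr.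
- move=> y'; apply: (@cvg_sum_dotr (nbhs y') y' _ u (fun y i => vof y i)) => i.
  exact: (@cvg_row_dsubmx (nbhs y') y' _ (@cvg_coord y')).
Qed.

(** Paired with one vector at all nodes, the antisymmetric edge terms cancel on the whole field. The
    bounds by 0 for [c] and for [- c] give equality. *)
Lemma filippov_hiso_sum_v y w (c : 'rV[R]_d) : filippov_map F y w ->
  \sum_i dotr c (vof w i) = 0.
Proof.
move=> yw; have F0 c' y' : \sum_i dotr c' (vof (F y') i) = 0.
  under eq_bigr do rewrite hiso_field_v hiso_vdotE.
  rewrite (sum_adjacency_antisym adjA (fun=> c')); last exact: coupling_antisym.
  rewrite big1 ?mulr0// => i _; rewrite big1// => j _.
  by rewrite subrr dotr0 mulr0.
have le0 c' : \sum_i dotr c' (vof w i) <= 0.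
  by apply: (filippov_hiso_v (h := fun=> 0)) yw => [y'|]; [rewrite F0|exact: cst_continuous].
apply/eqP; rewrite eq_le le0 /= -oppr_le0 -sumrN.
by under eq_bigr do rewrite -dotrNl; exact: le0.
Qed.

(** Used with [p] a coordinate of z_i - z_j frozen at [y] and [q] the same coordinate at a nearby
    state: the error |p - q| is continuous although the sign is not. *)
Lemma mulr_sgr_ge (p q : R) : - `|p - q| <= p * Num.sg q.
Proof.
have -> : p * Num.sg q = `|q| + (p - q) * Num.sg q by rewrite (normrEsg q); ring.
have : `|(p - q) * Num.sg q| <= `|p - q|.
  by rewrite normrM ler_piMr// normr_sg; case: (q != 0).
by rewrite ler_norml => /andP[+ _]; have := normr_ge0 q; lra.
Qed.

(** With weights frozen at [z y], the sign terms at [y'] contribute at most half the weighted sum of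
    the [gap i j y']. This majorant is continuous and vanishes at [y' = y], leaving the Laplacian
    term. *)
Lemma filippov_hiso_dissipation y w : filippov_map F y w ->
  \sum_i dotr (z y i) (vof w i) <= \sum_i dotr (z y i) (lap y i).
Proof.
pose gap i j y' := \sum_k `|(z y i - z y j) 0 k - (z y' i - z y' j) 0 k|.
pose h y' := \sum_i dotr (z y i) (lap y' i) + 2^-1 * \sum_i \sum_j A i j * gap i j y'.
have -> : \sum_i dotr (z y i) (lap y i) = h y.
  rewrite /h [X in _ * X]big1 ?mulr0 ?addr0// => i _.
  rewrite big1// => j _; rewrite /gap big1 ?mulr0// => k _.
  by rewrite subrr normr0.
apply: filippov_hiso_v.
  move=> y'; rewrite sum_hiso_vdot /h lerD2l -mulrN ler_wpM2l ?invr_ge0//.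
  rewrite -sumrN; apply: ler_sum => i _; rewrite -sumrN; apply: ler_sum => j _.
  rewrite -mulrN ler_wpM2l ?adjacency_ge0// lerNl -sumrN; apply: ler_sum => k _.
  by rewrite [sgn_vec _ 0 k]mxE mulr_sgr_ge.
apply: (@cvgD _ _ _ (nbhs y)).
  apply: (@cvg_sum_dotr (nbhs y) y _ (z y) lap) => i.
  exact: (@cvg_hiso_lap (nbhs y) y _ (@cvg_coord y)).
apply: (@cvgM _ _ (nbhs y)); first exact: cvg_cst.
exact: (@cvg_sum_gap (nbhs y) y _ (@cvg_coord y) (fun i j => z y i - z y j)).
Qed.

End hiso_filippov.

(** * Lyapunov function *)

Section energy_inequality.
Variables (R : realType) (N d : nat) (A : 'M[R]_N) (f : 'I_N -> 'rV[R]_d -> R).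
Variables (mlo mhi : 'I_N -> R) (xstar : 'rV[R]_d).
Hypotheses (adjA : is_adjacency A) (conA : graph_connected A).
Hypothesis (fC2 : forall i, C2 (f i)).
Hypothesis (mlohi : forall i, 0 < mlo i /\ mlo i <= mhi i).
Hypothesis (fmM : forall i x, loewner_le (mlo i)%:M (hessian (f i) x) /\
                              loewner_le (hessian (f i) x) (mhi i)%:M).
Hypothesis (xmin : forall y, \sum_(i < N) f i xstar <= \sum_(i < N) f i y).
Variable (i0 : 'I_N).
Local Notation g i := (gradient (f i)).

Let mhi_gt0 i : 0 < mhi i.
Proof. by have [m0 mM] := mlohi i; exact: lt_le_trans mM. Qed.

Lemma mhi_le_sum i : mhi i <= \sum_j mhi j.
Proof. by rewrite (bigD1 i) //= lerDl; apply: sumr_ge0 => j _; rewrite ltW. Qed.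

Lemma exists_uniform_mlo : exists m : R, 0 < m /\ forall i, m <= mlo i.
Proof.
have inv0 i : 0 < (mlo i)^-1 by rewrite invr_gt0; exact: (mlohi i).1.
have le_sum i : (mlo i)^-1 <= \sum_j (mlo j)^-1.
  by rewrite (bigD1 i) //= lerDl; apply: sumr_ge0 => j _; rewrite ltW.
have sum0 : 0 < \sum_j (mlo j)^-1 by exact: lt_le_trans (inv0 i0) (le_sum i0).
(* A positive lower bound obtained without a minimum over the nodes; [i0] makes the sum nonzero. *)
exists (\sum_j (mlo j)^-1)^-1; split; first by rewrite invr_gt0.
by move=> i; rewrite -[leRHS]invrK lef_pV2 ?posrE.
Qed.

(** Insert the step e = - M^-1 G into the quadratic upper bound: minimality gives 0 <= - |G|^2 / (2
    M). *)
Lemma sum_gradient_minimizer : \sum_i g i xstar = 0.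
Proof.
set G := \sum_i g i xstar; set M := \sum_i mhi i.
have M0 : 0 < M by exact: lt_le_trans (mhi_gt0 i0) (mhi_le_sum i0).
have ub e : 0 <= dotr G e + M / 2 * dotr e e.
  have : \sum_i (f i (xstar + e) - f i xstar) <=
      \sum_i (dotr (g i xstar) e + mhi i / 2 * dotr e e).
    apply: ler_sum => i _; have /andP[_] := bregman_bounds (fC2 i) (fmM i) xstar e.
    by rewrite lerBlDl.
  rewrite sumrB big_split /= -dotr_suml -!mulr_suml; apply: le_trans.
  by rewrite subr_ge0.
have := ub (- M^-1 *: G).
rewrite dotrZr dotrZl dotrZr.
have -> : - M^-1 * dotr G G + M / 2 * (- M^-1 * (- M^-1 * dotr G G)) =
    - (M^-1 / 2 * dotr G G) by field; rewrite gt_eqF.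
rewrite oppr_ge0 pmulr_rle0 ?divr_gt0 ?invr_gt0// => G0.
apply/rowP => k; rewrite [RHS]mxE; apply/eqP; rewrite -sqrf_eq0 eq_le sqr_ge0 andbT.
exact: le_trans (sqr_coord_le_dotr _ _) G0.
Qed.

(* Test the monotonicity of the gradients against X_i - X_(i0); the remaining
   term only involves \sum_i g_i(X_i) = \sum_i z_i. *)
Lemma distance_le_dissipation : exists C : R, 0 < C /\ forall X z : 'I_N -> 'rV[R]_d,
  \sum_i g i (X i) = \sum_i z i ->
  \sum_i dotr (X i - xstar) (X i - xstar) <=
    C * (2^-1 * dirichlet A X + \sum_i dotr (z i) (z i)).
Proof.
have [m [m0 mle]] := exists_uniform_mlo.
have [C [C0 HC]] := connected_poincare d adjA conA.
set M := \sum_i mhi i.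
have M0 : 0 < M by exact: lt_le_trans (mhi_gt0 i0) (mhi_le_sum i0).
have N0 : 0 < N%:R :> R by rewrite ltr0n (leq_ltn_trans _ (ltn_ord i0)).
(* The bracket adds the coefficients of [2^-1 * Q] and of [Z] found below, [2 / m] undoes the factor
   [m / 2] in front of [D], and [+ 1] ensures positivity. *)
pose C1 : R := 2 / m * (N%:R * (2 * M ^+ 2 / m) * C + N%:R / m) + 1.
have a0 : 0 <= N%:R * (2 * M ^+ 2 / m) * C.
  by rewrite !mulr_ge0 ?invr_ge0 ?(ltW m0) ?(ltW N0) ?(ltW M0).
have b0 : 0 <= N%:R / m by rewrite divr_ge0 ?(ltW m0).
exists C1; split.
  apply: ltr_wpDl => //; apply: mulr_ge0; last exact: addr_ge0.
  by rewrite divr_ge0// ltW.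
move=> X z gz.
set D := \sum_i dotr (X i - xstar) (X i - xstar).
set Q := dirichlet A X; set Z := \sum_i dotr (z i) (z i).
have Q0 : 0 <= Q by exact: dirichlet_ge0.
have Z0 : 0 <= Z by apply: sumr_ge0 => i _; exact: dotr_ge0.
have D0 : 0 <= D by apply: sumr_ge0 => i _; exact: dotr_ge0.
pose dl i := g i (X i) - g i xstar.
have mono : m * D <= \sum_i dotr (dl i) (X i - xstar).
  rewrite mulr_sumr; apply: ler_sum => i _.
  have /andP[H _] := gradient_increment_bounds (fC2 i) (fmM i) xstar (X i - xstar).
  rewrite (addrC xstar) subrK in H; apply: le_trans H.
  by rewrite ler_wpM2r ?dotr_ge0.
(* The gradients at [xstar] sum to zero, so the increments [dl i] have the same sum as the [z i],
   and X_(i0) - xstar factors out. *)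
have split_sum : \sum_i dotr (dl i) (X i - xstar) =
    \sum_i dotr (dl i) (X i - X i0) + \sum_i dotr (X i0 - xstar) (z i).
  have zE : \sum_i z i = \sum_i dl i by rewrite sumrB sum_gradient_minimizer subr0 gz.
  rewrite -dotr_sumr zE dotr_sumr -big_split; apply: eq_bigr => i _ /=.
  by rewrite (dotrC (X i0 - xstar)) -dotrDr addrA subrK.
have Dl i : dotr (X i - xstar) (X i - xstar) <= D.
  by rewrite /D (bigD1 i) //= lerDl; apply: sumr_ge0 => j _; exact: dotr_ge0.
have t1 : \sum_i dotr (dl i) (X i - X i0) <= m / 4 * D + N%:R * (M ^+ 2 / m * (C * Q)).
  have -> : N%:R * (M ^+ 2 / m * (C * Q)) = \sum_(i < N) (M ^+ 2 / m * (C * Q)).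
    by rewrite sumr_const card_ord mulr_natl.
  rewrite mulr_sumr -big_split; apply: ler_sum => i _ /=.
  (* This weight turns |dl i|^2 <= M^2 |X i - xstar|^2 into m / 4 times the squared distance; [t2]
     costs another m / 4, so half of [m * D] remains. *)
  have e0 : 0 < m / (2 * M ^+ 2) by rewrite divr_gt0// mulr_gt0// exprn_gt0.
  apply: le_trans (dotr_young _ _ e0) _; apply: lerD.
    have lip : dotr (dl i) (dl i) <= M ^+ 2 * dotr (X i - xstar) (X i - xstar).
      have [mi0 mMi] := mlohi i.
      apply: le_trans (gradient_lipschitz (fC2 i) mi0 mMi (fmM i) _ _) _.
      rewrite ler_wpM2r ?dotr_ge0// lerXn2r ?nnegrE ?(ltW (mhi_gt0 i)) ?(ltW M0)//.
      exact: mhi_le_sum.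
    have -> : m / 4 * dotr (X i - xstar) (X i - xstar) =
        m / (2 * M ^+ 2) / 2 * (M ^+ 2 * dotr (X i - xstar) (X i - xstar)).
      by field; rewrite gt_eqF.
    by rewrite ler_wpM2l// divr_ge0// ltW.
  have -> : (m / (2 * M ^+ 2))^-1 / 2 = M ^+ 2 / m by field; rewrite !gt_eqF.
  by rewrite ler_wpM2l ?divr_ge0 ?sqr_ge0 ?(ltW m0).
have t2 : \sum_i dotr (X i0 - xstar) (z i) <= m / 4 * D + N%:R / m * Z.
  (* Each of the N terms is charged the whole of [D], hence the division by N. *)
  have e0 : 0 < m / (2 * N%:R) by rewrite divr_gt0// mulr_gt0.
  have : \sum_i dotr (X i0 - xstar) (z i) <=
      \sum_(i < N) (m / (2 * N%:R) / 2 * D + N%:R / m * dotr (z i) (z i)).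
    apply: ler_sum => i _; apply: le_trans (dotr_young _ _ e0) _; apply: lerD.
      by rewrite ler_wpM2l ?Dl// divr_ge0// ltW.
    have -> : (m / (2 * N%:R))^-1 / 2 = N%:R / m by field; rewrite !gt_eqF.
    by [].
  have cst : \sum_(i < N) (m / (2 * N%:R) / 2 * D) = m / 4 * D.
    rewrite sumr_const card_ord -(mulr_natr (_ * D)); field; by rewrite gt_eqF.
  by rewrite big_split /= cst -mulr_sumr.
have main : m / 2 * D <= N%:R * (M ^+ 2 / m * (C * Q)) + N%:R / m * Z by lra.
have -> : D = 2 / m * (m / 2 * D) by field; rewrite gt_eqF.
apply: (@le_trans _ _ (2 / m * (N%:R * (M ^+ 2 / m * (C * Q)) + N%:R / m * Z))).
  by rewrite ler_wpM2l// divr_ge0// ltW.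
have -> : N%:R * (M ^+ 2 / m * (C * Q)) = N%:R * (2 * M ^+ 2 / m) * C * (2^-1 * Q).
  by field; rewrite gt_eqF.
have Q20 : 0 <= 2^-1 * Q by rewrite mulr_ge0// invr_ge0.
have k0 : 0 <= 2 / m by rewrite divr_ge0// ltW.
rewrite /C1 (mulrDl (2 / m * _)) mul1r.
have gen (p q s t : R) : 0 <= p -> 0 <= q -> 0 <= s -> 0 <= t ->
    p * s + q * t <= (p + q) * (s + t).
  by move=> p0 q0 s0 t0; rewrite mulrDl lerD// ler_wpM2l// ?lerDl ?lerDr.
apply: (@le_trans _ _ (2 / m * (N%:R * (2 * M ^+ 2 / m) * C + N%:R / m) * (2^-1 * Q + Z))).
  by rewrite -[leRHS]mulrA ler_wpM2l// gen.
by rewrite lerDl addr_ge0.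
Qed.

End energy_inequality.

Lemma norm_mx_le (R : realType) (m n : nat) (M : 'M[R]_(m, n)) (c : R) : 0 <= c ->
  (forall i j, `|M i j| <= c) -> `|M| <= c.
Proof.
move=> c0 Mc; rewrite /Num.Def.normr/= mx_normrE.
by apply: bigmax_le => // ij _; exact: Mc.
Qed.

Lemma is_derive1_dotr (R : realType) (d : nat) (u v : R -> 'rV[R]_d) (t : R)
    (du dv : 'rV[R]_d) :
  (forall k, is_derive t 1 (fun s => u s 0 k) (du 0 k)) ->
  (forall k, is_derive t 1 (fun s => v s 0 k) (dv 0 k)) ->
  is_derive t 1 (fun s => dotr (u s) (v s)) (dotr du (v t) + dotr (u t) dv).
Proof.
move=> hu hv; have := is_derive1_sum (fun k => is_derive1_mul (hu k) (hv k)).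
by rewrite big_split.
Qed.

Lemma derivable_mxsub (R : realType) (m n m' n' : nat) (Y : R -> 'M[R]_(m, n))
    (X : R -> 'M[R]_(m', n')) (a : 'I_m' -> 'I_m) (b : 'I_n' -> 'I_n) (t : R) :
  (forall s i j, X s i j = Y s (a i) (b j)) -> derivable Y t 1 ->
  derivable X t 1 /\ forall i j, derive1 X t i j = derive1 Y t (a i) (b j).
Proof.
move=> XY dY; have DX i j : is_derive t 1 (fun s => X s i j) (derive1 Y t (a i) (b j)).
  rewrite (_ : (fun s => _) = fun s => Y s (a i) (b j)); first exact: is_derive_coord.
  by apply/funext => s; rewrite XY.
have dX : derivable X t 1 by apply/derivable_mxP => i j; exact: ex_derive.
by split => // i j; rewrite derive1E derive_mx// mxE derive_val.
Qed.

(** The squared distance is O(1/t); it falls below e^2 once t exceeds |B| / (c e^2). *)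
Lemma cvg_row_rate (R : realType) (d : nat) (x : R -> 'rV[R]_d) (l : 'rV[R]_d)
    (B c : R) : 0 < c ->
  (forall t, 0 < t -> (1 + c * t) * dotr (x t - l) (x t - l) <= B) ->
  x t @[t --> +oo] --> l.
Proof.
move=> c0 xB; apply: (@cvg_mx R R (pinfty_nbhs R)) => o k; rewrite ord1.
apply/cvgrPdist_le => e e0; near=> t.
have t0 : 0 < t by near: t; apply: nbhs_pinfty_gt; exact: num_real.
have tB : `|B| / (c * e ^+ 2) < t by near: t; apply: nbhs_pinfty_gt; exact: num_real.
have e20 : 0 < e ^+ 2 by rewrite exprn_gt0.
rewrite distrC -(@ler_sqr R) ?nnegrE ?(ltW e0)// real_normK ?num_real//.
have := sqr_coord_le_dotr (x t - l) k; rewrite !mxE => /le_trans; apply.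
have ct0 : 0 < c * t by rewrite mulr_gt0.
rewrite -(@ler_pM2l _ (1 + c * t)) ?addr_gt0//; apply: le_trans (xB t t0) _.
apply: le_trans (ler_norm B) _.
rewrite ltr_pdivrMr ?mulr_gt0// in tB; nra.
Unshelve. all: by end_near. Qed.

Lemma ae_lebesgue_impl (R : realType) (P Q : R -> Prop) : (forall t, P t -> Q t) ->
  {ae (@lebesgue_measure R), forall t, P t} -> {ae (@lebesgue_measure R), forall t, Q t}.
Proof. by move=> PQ; apply: negligibleS => t /= nQ /PQ. Qed.

(** * The energy and its decay along a trajectory *)

Section trajectory.
Variables (R : realType) (N d : nat) (A : 'M[R]_N) (f : 'I_N -> 'rV[R]_d -> R).
Variables (mlo mhi : 'I_N -> R) (xstar : 'rV[R]_d).
Hypotheses (adjA : is_adjacency A) (conA : graph_connected A).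
Hypothesis (fC2 : forall i, C2 (f i)).
Hypothesis (mlohi : forall i, 0 < mlo i /\ mlo i <= mhi i).
Hypothesis (fmM : forall i x, loewner_le (mlo i)%:M (hessian (f i) x) /\
                              loewner_le (hessian (f i) x) (mhi i)%:M).
Hypothesis (xmin : forall y, \sum_(i < N) f i xstar <= \sum_(i < N) f i y).
Hypothesis (d0 : (0 < d)%N).
Variable (i0 : 'I_N).
Local Notation xof y i := (row i (usubmx y)).
Local Notation vof y i := (row i (dsubmx y)).
Local Notation z := (hiso_z f).
Local Notation lap := (hiso_lap A).
Local Notation F := (hiso_field A f).
Local Notation g i := (gradient (f i)).

Let N0 : (0 < N)%N := leq_ltn_trans (leq0n i0) (ltn_ord i0).

(** The base point of each divergence is the moving [x^i], not [xstar]: its derivative is then the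
    Hessian applied to the velocity, paired with x^i - xstar, and the inverse Hessian of the
    algorithm cancels. *)
Definition hiso_energy (K : R) (y : 'M[R]_(N + N, d)) : R :=
  \sum_i (f i xstar - f i (xof y i) - dotr (g i (xof y i)) (xstar - xof y i)) +
  K / 2 * \sum_i dotr (z y i) (z y i).

Let bregman_star i (x : 'rV[R]_d) :
  mlo i / 2 * dotr (x - xstar) (x - xstar) <=
    f i xstar - f i x - dotr (g i x) (xstar - x) <=
  mhi i / 2 * dotr (x - xstar) (x - xstar).
Proof.
have := bregman_bounds (fC2 i) (fmM i) x (xstar - x).
have -> : x + (xstar - x) = xstar by rewrite addrC subrK.
suff -> : dotr (xstar - x) (xstar - x) = dotr (x - xstar) (x - xstar) by [].
by rewrite -(opprB x xstar) dotrNl dotrNr opprK.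
Qed.

Let bregman_star_ge0 i x : 0 <= f i xstar - f i x - dotr (g i x) (xstar - x).
Proof.
have /andP[+ _] := bregman_star i x; apply: le_trans.
by rewrite mulr_ge0 ?dotr_ge0// divr_ge0// ltW//; exact: (mlohi i).1.
Qed.

Lemma energy_ge_x K y i : 0 <= K ->
  mlo i / 2 * dotr (xof y i - xstar) (xof y i - xstar) <= hiso_energy K y.
Proof.
move=> K0; have /andP[+ _] := bregman_star i (xof y i); move=> /le_trans; apply.
rewrite /hiso_energy (bigD1 i) //=.
set a := _ - dotr _ _; set b := \sum_(j | _) _.
have b0 : 0 <= b by apply: sumr_ge0 => j _; exact: bregman_star_ge0.
have : 0 <= K / 2 * \sum_i dotr (z y i) (z y i).
  by rewrite mulr_ge0 ?divr_ge0//; apply: sumr_ge0 => j _; exact: dotr_ge0.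
lra.
Qed.

Lemma energy_ge_z K y i : 0 <= K -> K / 2 * dotr (z y i) (z y i) <= hiso_energy K y.
Proof.
move=> K0; rewrite /hiso_energy.
have : 0 <= \sum_i (f i xstar - f i (xof y i) - dotr (g i (xof y i)) (xstar - xof y i)).
  by apply: sumr_ge0 => j _; exact: bregman_star_ge0.
have : K / 2 * dotr (z y i) (z y i) <= K / 2 * \sum_i dotr (z y i) (z y i).
  rewrite ler_wpM2l ?divr_ge0// (bigD1 i) //= lerDl.
  by apply: sumr_ge0 => j _; exact: dotr_ge0.
lra.
Qed.

Lemma energy_le K y : hiso_energy K y <=
  (\sum_i mhi i) / 2 * \sum_i dotr (xof y i - xstar) (xof y i - xstar) +
  K / 2 * \sum_i dotr (z y i) (z y i).
Proof.
rewrite lerD2r [leRHS]mulr_sumr; apply: ler_sum => i _.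
have /andP[_ +] := bregman_star i (xof y i); move=> /le_trans; apply.
rewrite ler_wpM2r ?dotr_ge0// ler_wpM2r ?invr_ge0//.
exact: (mhi_le_sum mlohi).
Qed.

(** The velocity [w] is a separate argument because along a solution only its membership in the
    Filippov set is known. *)
Definition hiso_energy_rate (K : R) (y w : 'M[R]_(N + N, d)) : R :=
  \sum_i dotr (xof w i *m (hessian (f i) (xof y i))^T) (xof y i - xstar) +
  K * \sum_i dotr (z y i) (xof w i *m (hessian (f i) (xof y i))^T + vof w i).

Lemma is_derive_energy K (Y : R -> 'M[R]_(N + N, d)) (t : R) : derivable Y t 1 ->
  is_derive t 1 (fun s => hiso_energy K (Y s)) (hiso_energy_rate K (Y t) (derive1 Y t)).
Proof.
move=> dY.
have rowx i : derivable (fun s => xof (Y s) i) t 1 /\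
    derive1 (fun s => xof (Y s) i) t = xof (derive1 Y t) i.
  have [|dX DX] := @derivable_mxsub R _ _ _ _ Y (fun s => xof (Y s) i)
    (fun=> lshift N i) id t _ dY; first by move=> s o k; rewrite !mxE.
  by split => //; apply/matrixP => o k; rewrite DX !mxE.
have Dx i k : is_derive t 1 (fun s => xof (Y s) i 0 k) (xof (derive1 Y t) i 0 k).
  by have [dX <-] := rowx i; exact: is_derive_coord.
have Dv i k : is_derive t 1 (fun s => vof (Y s) i 0 k) (vof (derive1 Y t) i 0 k).
  rewrite row_dsubmxE (_ : (fun s => _) = fun s => Y s (rshift N i) k).
    exact: is_derive_coord.
  by apply/funext => s; rewrite row_dsubmxE.
have Dg i k : is_derive t 1 (fun s => g i (xof (Y s) i) 0 k)
    ((xof (derive1 Y t) i *m (hessian (f i) (xof (Y t) i))^T) 0 k).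
  have [dX <-] := rowx i; exact: (is_derive_hessian k dX ((fC2 i).2.1 _)).
have Df i : is_derive t 1 (fun s => f i (xof (Y s) i))
    (dotr (g i (xof (Y t) i)) (xof (derive1 Y t) i)).
  have [dX <-] := rowx i; exact: (is_derive_gradient dX ((fC2 i).1 _)).
have Dz i k : is_derive t 1 (fun s => z (Y s) i 0 k)
    ((xof (derive1 Y t) i *m (hessian (f i) (xof (Y t) i))^T + vof (derive1 Y t) i) 0 k).
  rewrite (_ : (fun s => _) = fun s => g i (xof (Y s) i) 0 k + vof (Y s) i 0 k); last first.
    by apply/funext => s; rewrite [LHS]mxE.
  by rewrite [X in is_derive _ _ _ X]mxE; exact: is_derive1_add.
have Dc (a : R) : is_derive t 1 (fun=> a : R) 0 by exact: is_derive_cst.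
have De i k : is_derive t 1 (fun s => (xstar - xof (Y s) i) 0 k) ((- xof (derive1 Y t) i) 0 k).
  rewrite (_ : (fun s => _) = fun s => xstar 0 k - xof (Y s) i 0 k); last first.
    by apply/funext => s; rewrite [LHS]mxE [X in _ + X]mxE.
  by rewrite [X in is_derive _ _ _ X]mxE -sub0r; exact: is_derive1_sub.
have D1 i := is_derive1_sub (is_derive1_sub (Dc (f i xstar)) (Df i))
  (is_derive1_dotr (Dg i) (De i)).
have D2 i := is_derive1_dotr (Dz i) (Dz i).
apply: (is_derive1_eq (is_derive1_add (is_derive1_sum D1)
  (is_derive1_scale (K / 2) (is_derive1_sum D2)))).
rewrite /hiso_energy_rate; congr (_ + _).
  by apply: eq_bigr => i _; rewrite -(opprB (xof (Y t) i) xstar) !dotrNr; ring.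
rewrite -mulrA; congr (_ * _); rewrite mulr_sumr; apply: eq_bigr => i _.
by rewrite [X in X + _]dotrC; field.
Qed.

Lemma energy_rate_le (K : R) (y w : 'M[R]_(N + N, d)) : 0 <= K -> filippov_map F y w ->
  hiso_energy_rate K y w <= - \sum_i dotr (xof y i - xstar) (z y i) -
    2^-1 * dirichlet A (fun i => xof y i) - K * \sum_i dotr (z y i) (z y i).
Proof.
move=> K0 yw; apply: lerD.
  under eq_bigr do rewrite (filippov_hiso_hessian fC2 mlohi fmM N0 d0 _ yw).
  under eq_bigr do rewrite dotrC dotrNr dotrDr.
  rewrite sumrN big_split /= opprD lerD2l lerN2.
  rewrite (sum_adjacency_antisym adjA (fun i => xof y i - xstar)); last first.
    by move=> i j; rewrite opprB.
  rewrite ler_wpM2l ?invr_ge0//; apply: ler_sum => i _; apply: ler_sum => j _.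
  by rewrite opprB addrA subrK.
(* For the sign coupling only an inequality is available, so [0 <= K] is used to scale it. *)
rewrite -mulrN ler_wpM2l//.
under eq_bigr do rewrite (filippov_hiso_hessian fC2 mlohi fmM N0 d0 _ yw).
under eq_bigr do rewrite dotrDr dotrNr dotrDr.
rewrite big_split /= sumrN big_split /=.
have := filippov_hiso_dissipation adjA fC2 N0 d0 yw; lra.
Qed.

Lemma energy_decay : exists K c : R, [/\ 0 < K, 0 < c & forall y w,
  \sum_i vof y i = 0 -> filippov_map F y w ->
  hiso_energy_rate K y w <= - (c * hiso_energy K y)].
Proof.
have [C [C0 HC]] := distance_le_dissipation adjA conA fC2 mlohi fmM xmin i0.
pose M := \sum_i mhi i.
have M0 : 0 < M.
  have [m0 mM] := mlohi i0; apply: lt_le_trans (mhi_le_sum mlohi i0).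
  exact: lt_le_trans mM.
(* Young with weight 1 / C bounds the cross term by D / (2 C) + (C / 2) Z. The part C / 2 of [K]
   cancels the last term; of the remaining 2 Z, one Z joins Q to dominate D / C, so the rate is at
   most - D / (2 C) - Z. *)
pose K : R := C / 2 + 2; have K0 : 0 < K by rewrite /K; lra.
have CM0 : 0 < C * M by rewrite mulr_gt0.
have CMK : 0 < C * M + K by rewrite addr_gt0.
(* Ensures c M <= 1 / C and c K <= 1, so c times the energy is at most D / (2 C) + Z. *)
pose c : R := (C * M + K)^-1; have c0 : 0 < c by rewrite invr_gt0.
exists K, c; split => // y w sv yw.
apply: le_trans (energy_rate_le (ltW K0) yw) _.
set D := \sum_i dotr (xof y i - xstar) (xof y i - xstar).
have := energy_le K y; have := HC (fun i => xof y i) (z y) _.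
rewrite -/D -/M big_split /= sv addr0 => /(_ erefl).
set Q := _ * dirichlet _ _; set Z := \sum_i dotr (z y i) (z y i) => DQ UD.
have D0 : 0 <= D by apply: sumr_ge0 => i _; exact: dotr_ge0.
have Z0 : 0 <= Z by apply: sumr_ge0 => i _; exact: dotr_ge0.
have young : - \sum_i dotr (xof y i - xstar) (z y i) <= C^-1 / 2 * D + C / 2 * Z.
  rewrite /D /Z !mulr_sumr -sumrN -big_split; apply: ler_sum => i _ /=.
  have := dotr_young (- (xof y i - xstar)) (z y i) (e := C^-1).
  by rewrite invrK dotrNl dotrNl dotrNr opprK; apply; rewrite invr_gt0.
have DQ' : C^-1 * D <= Q + Z by rewrite mulrC ler_pdivrMr// mulrC.
have cU : c * hiso_energy K y <= c * (M / 2 * D) + c * (K / 2 * Z).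
  by rewrite -[leRHS]mulrDr ler_wpM2l// ltW.
have cM : c * (M / 2 * D) <= C^-1 / 2 * D.
  rewrite !mulrA ler_wpM2r// ler_wpM2r ?invr_ge0//.
  rewrite /c ler_pdivrMl// mulrC ler_pdivlMl//; lra.
have cK : c * (K / 2 * Z) <= Z.
  rewrite !mulrA ler_piMl// ler_pdivrMr// mul1r /c ler_pdivrMl//; lra.
have KZ : K * Z = C / 2 * Z + 2 * Z by rewrite /K; ring.
have halfD : C^-1 / 2 * D = C^-1 * D / 2 by rewrite mulrAC.
rewrite halfD in young cM; rewrite KZ.
move: young DQ' cU cM cK; clear.
move: (C^-1 * D) (C / 2 * Z) (c * (M / 2 * D)) (c * (K / 2 * Z)) (c * hiso_energy K y).
by move: (\sum_i dotr (xof y i - xstar) (z y i)) => *; lra.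
Qed.

Variable Y : R -> 'M[R]_(N + N, d).
Hypothesis solY : filippov_solution F Y.
Hypothesis sumv0 : \sum_i vof (Y 0) i = 0.

(** For each constant [c] the pairing of [c] with the sum is nonincreasing and starts at 0. Choosing
    for [c] the value of the sum at time [t] makes its squared length nonpositive. *)
Lemma sum_v_eq0 t : 0 <= t -> \sum_i vof (Y t) i = 0.
Proof.
move=> t0; have [acY aeY] := solY.
pose s (c : 'rV[R]_d) r := \sum_i dotr c (vof (Y r) i).
have nonincr c : s c t <= s c 0.
  have [->//|tn0] := eqVneq t 0.
  have tp : 0 < t by rewrite lt_neqAle eq_sym tn0.
  apply: abs_cont_nonincreasing => //.
    have [L HL] : dominated Y 0 t (s c).
      apply: dominated_sum => i; apply: dominated_sum => k.
      apply: dominated_scale; have := dominated_coord Y 0 t (rshift N i) k.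
      by congr (dominated Y); apply/funext => r; rewrite row_dsubmxE.
    exact: abs_cont_fun_dominated (acY t tp) HL.
  apply: ae_lebesgue_impl aeY => r rY r0; have [dY FY] := rY r0.
  have Ds : is_derive r 1 (s c) (\sum_i dotr c (vof (derive1 Y r) i)).
    have Dk i k : is_derive r 1 (fun q => vof (Y q) i 0 k) (vof (derive1 Y r) i 0 k).
      rewrite row_dsubmxE (_ : (fun q => _) = fun q => Y q (rshift N i) k).
        exact: is_derive_coord.
      by apply/funext => q; rewrite row_dsubmxE.
    exact: is_derive1_sum (fun i => is_derive1_sum (fun k => is_derive1_scale (c 0 k) (Dk i k))).
  split; first exact: ex_derive.
  by rewrite derive1E derive_val (filippov_hiso_sum_v adjA N0 d0 c FY).
have s0 c : s c 0 = 0 by rewrite /s -dotr_sumr sumv0 dotrC dotr0.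
have le0 c : s c t <= 0 by rewrite -(s0 c).
apply/rowP => k; rewrite [RHS]mxE.
have : dotr (\sum_i vof (Y t) i) (\sum_i vof (Y t) i) <= 0.
  by rewrite dotr_sumr; exact: le0.
move=> /(le_trans (sqr_coord_le_dotr _ k)) h.
by apply/eqP; rewrite -sqrf_eq0 eq_le h sqr_ge0.
Qed.

Lemma dominated_energy K t : 0 < t -> dominated Y 0 t (fun s => hiso_energy K (Y s)).
Proof.
move=> t0; have [acY _] := solY; have acYt := acY t t0.
have xY i s r : `|xof (Y r) i - xof (Y s) i| <= `|Y r - Y s|.
  apply: norm_mx_le => // o k; have := coord_le_norm (Y r - Y s) (lshift N i) k.
  by rewrite !mxE.
have dg i k := dominated_gradient (fC2 i) (mlohi i).1 (mlohi i).2 (fmM i) 0 t (xY i) k.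
have df i := dominated_fun (fC2 i) (mlohi i).1 (mlohi i).2 (fmM i) (ltW t0) acYt (xY i).
have dx i k := dominated_row 0 t (xY i) k.
have dv i k : dominated Y 0 t (fun s => vof (Y s) i 0 k).
  have := dominated_coord Y 0 t (rshift N i) k.
  by congr (dominated Y); apply/funext => r; rewrite row_dsubmxE.
apply: dominated_add.
  apply: dominated_sum => i; apply: dominated_sub.
    by apply: dominated_sub => //; exact: dominated_cst.
  apply: dominated_sum => k; apply: (dominated_mul (ltW t0) acYt) => //.
  have := dominated_sub (dominated_cst Y 0 t (xstar 0 k)) (dx i k).
  by congr (dominated Y); apply/funext => r; rewrite [RHS]mxE [X in _ = _ + X]mxE.
apply: dominated_scale; apply: dominated_sum => i; apply: dominated_sum => k.
have dz : dominated Y 0 t (fun s => z (Y s) i 0 k).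
  have := dominated_add (dg i k) (dv i k).
  by congr (dominated Y); apply/funext => r; rewrite [RHS]mxE.
exact: (dominated_mul (ltW t0) acYt).
Qed.

Lemma energy_rate_bound : exists K c : R, [/\ 0 < K, 0 < c &
  forall t, 0 < t -> (1 + c * t) * hiso_energy K (Y t) <= hiso_energy K (Y 0)].
Proof.
have [K [c [K0 c0 decay]]] := energy_decay; exists K, c; split => // t t0.
have [acY aeY] := solY; have acYt := acY t t0.
(* From E' <= - c E the product has derivative at most c E - (1 + c s) c E = - c^2 s E <= 0. This
   affine factor replaces an exponential and is plainly dominated. *)
pose u s := (1 + c * s) * hiso_energy K (Y s).
suff : u t <= u 0 by rewrite /u mulr0 addr0 mul1r.
apply: abs_cont_nonincreasing (ltW t0) _ _.
  have [L HL] : dominated Y 0 t u.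
    apply: (dominated_mul (ltW t0) acYt); last exact: dominated_energy.
    apply: dominated_add; first exact: dominated_cst.
    by apply: dominated_scale; exact: dominated_id.
  exact: abs_cont_fun_dominated acYt HL.
apply: ae_lebesgue_impl aeY => s sY s0; have [dY FY] := sY s0.
have D1 : is_derive s 1 (fun r : R => r) 1 by exact: is_derive_id.
have Dc (a : R) : is_derive s 1 (fun=> a : R) 0 by exact: is_derive_cst.
have Du := is_derive1_mul (is_derive1_add (Dc 1) (is_derive1_scale c D1))
  (is_derive_energy K dY).
split; first exact: ex_derive.
rewrite derive1E derive_val.
have := decay _ _ (sum_v_eq0 (ltW s0)) FY.
have E0 : 0 <= hiso_energy K (Y s).
  apply: le_trans (energy_ge_z (Y s) i0 (ltW K0)).
  by rewrite mulr_ge0 ?dotr_ge0// divr_ge0// ltW.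
set E := hiso_energy K (Y s) in E0 *; set dE := hiso_energy_rate _ _ _ => h.
have cs0 : 0 <= 1 + c * s by rewrite addr_ge0// mulr_ge0// ltW.
have h1 : (1 + c * s) * dE <= (1 + c * s) * - (c * E) by rewrite ler_wpM2l.
have h2 : 0 <= c * s * (c * E) by rewrite !mulr_ge0// ltW.
rewrite add0r mulr1; lra.
Qed.

Lemma hiso_convergence i :
  (xof (Y t) i @[t --> +oo] --> xstar) /\ (z (Y t) i @[t --> +oo] --> (0 : 'rV[R]_d)).
Proof.
have [K [c [K0 c0 H]]] := energy_rate_bound; have [m0 _] := mlohi i.
set E0 := hiso_energy K (Y 0) in H.
have ct0 t : 0 < t -> 0 <= 1 + c * t by move=> t0; rewrite addr_ge0// mulr_ge0// ltW.
split.
  apply: (@cvg_row_rate R d _ _ (2 / mlo i * E0) c) => // t t0.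
  have h := le_trans (ler_wpM2l (ct0 t t0) (energy_ge_x (Y t) i (ltW K0))) (H t t0).
  rewrite -(@ler_pM2l _ (mlo i / 2)) ?divr_gt0//.
  by rewrite mulrCA (le_trans h)// !mulrA divfK// mulfV ?mul1r// gt_eqF.
apply: (@cvg_row_rate R d _ _ (2 / K * E0) c) => // t t0.
have h := le_trans (ler_wpM2l (ct0 t t0) (energy_ge_z (Y t) i (ltW K0))) (H t t0).
rewrite subr0 -(@ler_pM2l _ (K / 2)) ?divr_gt0//.
by rewrite mulrCA (le_trans h)// !mulrA divfK// mulfV ?mul1r// gt_eqF.
Qed.

End trajectory.

Theorem theorem2 (R : realType) (N d : nat) (A : 'M[R]_N)
    (f : 'I_N -> 'rV[R]_d -> R) (mlo mhi : 'I_N -> R) (xstar : 'rV[R]_d) :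
  is_adjacency A -> graph_connected A ->
  (forall i, C2 (f i)) ->
  (forall i, 0 < mlo i /\ mlo i <= mhi i) ->
  (forall i x, loewner_le (mlo i)%:M (hessian (f i) x) /\
               loewner_le (hessian (f i) x) (mhi i)%:M) ->
  (forall y, \sum_(i < N) f i xstar <= \sum_(i < N) f i y) ->
  (forall y, (forall w, \sum_(i < N) f i y <= \sum_(i < N) f i w) -> y = xstar) ->
  forall Y : R -> 'M[R]_(N + N, d),
    filippov_solution (hiso_field A f) Y ->
    \sum_(i < N) row i (dsubmx (Y 0)) = 0 ->
    forall i : 'I_N,
      (row i (usubmx (Y t)) @[t --> +oo] --> xstar) /\
      (hiso_z f (Y t) i @[t --> +oo] --> (0 : 'rV[R]_d)).
Proof.
move=> adjA conA fC2 mlohi fmM xmin _ Y solY sumv0 i.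
(* For d = 0 even the empty set is not null under [null_set], but there are no coordinates to check.
   The node [i] itself supplies 0 < N. *)
have [d0|d0] := posnP d; last exact: (hiso_convergence adjA conA fC2 mlohi fmM xmin d0 i).
by split; apply: (@cvg_mx R R (pinfty_nbhs R)) => o k;
  have := leq_ltn_trans (leq0n k) (ltn_ord k); rewrite [X in (_ < X)%N]d0.
Qed.
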